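(* Let $X$ be a separable Banach space with the Radon–Nikodym property and let $\Omega\subset X$ be a convex domain, with quasihyperbolic metric $k=k_\Omega$. Then the function $(x,y)\mapsto k(x,y)$ is Gâteaux differentiable at every point of some dense $G_\delta$ subset of $\Omega\times\Omega$. Moreover, for each fixed $x_0\in\Omega$, the function $k_{x_0}(y):=k(x_0,y)$ is Gâteaux differentiable at every point of some dense $G_\delta$ subset of $\Omega$.
   Context: Banach spaces are real. A domain $\Omega\subset X$ is an open path-connected subset with non-empty boundary $\partial\Omega$. Write $d(z,\partial\Omega)$ for the norm distance from $z$ to $\partial\Omega$. The quasihyperbolic metric on $\Omega$ is $$k_\Omega(x,y)=\inf_\gamma\int_\gamma\frac{\|dz\|}{d(z,\partial\Omega)},$$ the infimum being over all rectifiable curves $\gamma$ in $\Omega$ joining $x$ and $y$. $X$ has the Radon–Nikodym property if each Lipschitz path $\gamma\colon[0,1]\to X$ is a.e. differentiable and $\gamma(t)=\gamma(0)+\int_0^t\gamma'(s)\,ds$ (Bochner integral) for all $t\in[0,1]$. *)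

(* Defs.v *)
From mathcomp Require Import all_boot all_order all_algebra.
From mathcomp Require Import all_classical all_reals all_analysis.
From mathcomp Require Import borel_hierarchy.

Set Implicit Arguments.
Unset Strict Implicit.
Unset Printing Implicit Defensive.

Import Order.TTheory GRing.Theory Num.Theory.
Import numFieldNormedType.Exports.

Local Open Scope classical_set_scope.
Local Open Scope ring_scope.

Definition separable (T : topologicalType) : Prop :=
  exists2 D : set T, countable D & dense D.

Definition boundary (T : topologicalType) (A : set T) : set T :=
  closure A `\` interior A.

(** Meaningful for an open [U], where the G-delta subsets of the subspace [U]
    are exactly the G-delta subsets of the whole space that lie in [U]. *)
Definition dense_Gdelta_in (T : topologicalType) (U G : set T) : Prop :=
  [/\ Gdelta G, G `<=` U & U `<=` closure G].

Section bochner.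
Context d (T : measurableType d) (R : realType) (X : normedModType R).
Variables (mu : {measure set T -> \bar R}) (D : set T).
Implicit Types s f : T -> X.

Definition simple_integrable s : Prop :=
  [/\ finite_set (range s),
      forall x, measurable (D `&` s @^-1` [set x]) &
      forall x, x != 0 -> (mu (D `&` s @^-1` [set x]) < +oo)%E].

(** The value [x = 0], whose level set may have infinite measure, contributes
    nothing to the sum. *)
Definition simple_integral s : X :=
  \sum_(x \in range s) fine (mu (D `&` s @^-1` [set x])) *: x.

(** [f] is Bochner integrable on [D], with integral [v]. The almost everywhere
    convergence makes [f] strongly measurable: without it, [`|f t - s n t|]
    might not be measurable and its integral would only be a lower one. *)
Definition is_bochner_integral f (v : X) : Prop :=
  exists s : nat -> T -> X,
    [/\ forall n, simple_integrable (s n),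
        {ae mu, forall t, D t -> s n t @[n --> \oo] --> f t},
        (\int[mu]_(t in D) (`|f t - s n t|)%:E)%E @[n --> \oo] --> 0%E &
        simple_integral (s n) @[n --> \oo] --> v].

End bochner.

(** Paths [0, 1] -> X are total functions on [R], of which only the values on
    [0, 1] matter: the endpoints, where [derivable] and [derive1] look outside
    of [0, 1], form a null set. *)
Definition radon_nikodym_property (R : realType) (X : normedModType R) : Prop :=
  forall gamma : R -> X,
    [lipschitz gamma t | t in `[0, 1]%classic] ->
    {ae lebesgue_measure, forall t : R, t \in `[0, 1] -> derivable gamma t 1} /\
    forall t : R, t \in `[0, 1] ->
      exists2 v, is_bochner_integral lebesgue_measure `[0, t]%classic
                   gamma^`()%classic v
               & gamma t = gamma 0 + v.

Section curves.
Context (R : realType) (X : normedModType R).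
Implicit Types (gamma : R -> X) (Omega : set X) (x y : X).

Definition path_in Omega x y gamma : Prop :=
  [/\ {within `[0, 1], continuous gamma}, gamma 0 = x, gamma 1 = y &
      gamma @` `[0, 1] `<=` Omega].

Definition path_connected Omega : Prop :=
  forall x y, Omega x -> Omega y -> exists gamma, path_in Omega x y gamma.

Definition is_domain Omega : Prop :=
  [/\ open Omega, path_connected Omega & boundary Omega !=set0].

(** The library's [variation], [variations] and [total_variation], which are
    restricted to real-valued functions, for values in [X]. *)
Definition variation_sum (a b : R) gamma (s : seq R) : R :=
  let F := gamma \o nth b (a :: s) in
  \sum_(0 <= n < size s) `|F n.+1 - F n|.

Definition path_length (a b : R) gamma : \bar R :=
  ereal_sup [set (variation_sum a b gamma s)%:E | s in itv_partition a b].

Definition rectifiable gamma : Prop := (path_length 0 1 gamma < +oo)%E.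

(** The point of the curve at arc length [s] from [gamma 0]. It does not depend
    on the parameter [t] that [xget] picks: [gamma] is constant between two
    parameters with the same arc length. *)
Definition arc_param gamma (s : R) : X :=
  gamma (xget 0 [set t : R | t \in `[0, 1] /\ path_length 0 t gamma = s%:E]).

Definition line_integral gamma (rho : X -> R) : \bar R :=
  (\int[lebesgue_measure]_(s in `[0%R, fine (path_length 0 1 gamma)])
     (rho (arc_param gamma s))%:E)%E.

Definition set_dist x (A : set X) : R := inf [set `|x - a| | a in A].

Definition qh_metric Omega x y : R :=
  fine (ereal_inf [set line_integral gamma
                         (fun z => (set_dist z (boundary Omega))^-1)
                  | gamma in [set gamma | path_in Omega x y gamma /\
                                          rectifiable gamma]]).

Definition gateaux_differentiable (f : X -> R) x : Prop :=
  exists2 L : {linear X -> R^o}, continuous L &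
    forall v, is_derive x v (f : X -> R^o) (L v).

End curves.

(* Main.v *)
From HB Require Import structures.
Require Import Defs.
From mathcomp Require Import all_boot all_order all_algebra.
From mathcomp Require Import all_classical all_reals all_analysis.
From mathcomp Require Import measurable_realfun ring lra.
Import Order.TTheory GRing.Theory Num.Theory.
Import numFieldNormedType.Exports.
Local Open Scope classical_set_scope.
Local Open Scope ring_scope.
Set Implicit Arguments.
Unset Strict Implicit.
Unset Printing Implicit Defensive.

(** Near each pair of points of a convex domain, the quasihyperbolic distance
    [k] is Lipschitz and semiconvex, in the sense that
      [k (p + t (q - p)) <= k p + t (k q - k p) + C t |q - p|^2]
    for [p], [q] close to that pair and [t] in [0, 1] (lemma [qh_local]). On a
    separable Banach space, these two properties of a real function imply
    Gateaux differentiability on a dense G-delta set ([generic_gateaux]). The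
    two claims of the theorem are the cases of [k] itself, on the product space,
    and of [k] with its first argument fixed.

    Semiconvexity of [k]. By convexity of the domain, the distance [d] to the
    boundary is concave ([boundary_dist_concave]). If two curves [g0], [g1] run
    with quasihyperbolic speed 1, that is, with norm speed [d g0] and [d g1],
    then their convex combination has norm speed at most
    [(1 - t) d g0 + t d g1 <= d ((1 - t) g0 + t g1)], so its quasihyperbolic
    speed is at most 1. If [g0] is longer than [g1], then [g1] waits at its end
    point [y1] while [g0] spends the remaining time [k0 - k1]; the combination
    then has speed [(1 - t) d g0] at distance at least [(1 - t) d g0 + t d y1]
    from the boundary, which would be [1 - t] times the speed of [g0] if [d y1]
    were equal to [d g0]. Both [k0 - k1] and the relative difference between
    these distances are of the order of the distance between the end points,
    which gives a quadratic error ([qh_average], [qh_average_local]).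

    In order to reparametrise without derivatives, curves are replaced by chains
    of points [z i] with [|z (i + 1) - z i| <= th * d (z i)]. A curve of
    quasihyperbolic length less than [T] is cut into a chain of [N] steps as
    soon as [th] is small and [T <= N * th] ([qh_chain]); a chain is the list of
    vertices of a polygon whose quasihyperbolic length is at most the sum of the
    [th / (1 - th)] ([unit_speed_path_chain], [qh_le]).

    Generic differentiability. A semiconvex Lipschitz function [f] has right
    derivatives in all directions, and they form a Lipschitz sublinear map. This
    map is linear at [x] if, for all [v] in a countable dense set, the second
    difference [f (x + s v) + f (x - s v) - 2 f x] is small with respect to [s]
    for some arbitrarily small [s] ([semiconvex_gateaux]). For a fixed [v] and
    a fixed tolerance, this is an open condition on [x]; it holds on a dense set
    because the second differences along an arithmetic progression telescope
    ([second_difference_small]). Baire's theorem concludes. *)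

(** * Right derivatives of semiconvex functions *)

Section one_sided_derivative.
Context (R : realType) (Y : normedModType R).
Implicit Types (f : Y -> R) (p u v w : Y) (L : R).

Definition right_derivative f p v L :=
  forall e, 0 < e -> exists2 h : R, 0 < h &
    forall s, 0 < s < h -> `|f (p + s *: v) - f p - s * L| <= e * s.

Definition lipschitz_near f p (r C : R) := forall a b,
  `|a - p| < r -> `|b - p| < r -> `|f a - f b| <= C * `|a - b|.

(** The error has the factor [t] rather than [t * (1 - t)] because it is used to
    compare difference quotients at [a], where only its vanishing at [t = 0]
    matters. *)
Definition semiconvex_near f p (r C : R) := forall a b t,
  `|a - p| < r -> `|b - p| < r -> 0 <= t <= 1 ->
  f (a + t *: (b - a)) <= f a + t * (f b - f a) + C * t * `|b - a| ^+ 2.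

Lemma right_derivative_le f g p v w L M (c : R) :
  right_derivative f p v L -> right_derivative g p w M ->
  (forall e, 0 < e -> exists2 h : R, 0 < h & forall s, 0 < s < h ->
     f (p + s *: v) - f p <= g (p + s *: w) - g p + (c + e) * s) ->
  L <= M + c.
Proof.
move=> fL gM fg; apply/ler_addgt0Pr => e e0.
have e3 : 0 < e / 3 by lra.
have [h1 h10 H1] := fL _ e3; have [h2 h20 H2] := gM _ e3.
have [h3 h30 H3] := fg _ e3.
pose s := Num.min h1 (Num.min h2 h3) / 2.
have m0 : 0 < Num.min h1 (Num.min h2 h3) by rewrite !lt_min h10 h20.
have m1 : Num.min h1 (Num.min h2 h3) <= h1 by rewrite !ge_min lexx.
have m2 : Num.min h1 (Num.min h2 h3) <= h2 by rewrite !ge_min lexx !orbT.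
have m3 : Num.min h1 (Num.min h2 h3) <= h3 by rewrite !ge_min lexx !orbT.
have s0 : 0 < s by rewrite /s; lra.
have /H1 : 0 < s < h1 by rewrite /s; lra.
have /H2 : 0 < s < h2 by rewrite /s; lra.
have /H3 : 0 < s < h3 by rewrite /s; lra.
move=> A; rewrite !ler_norml => /andP[B1 B2] /andP[D1 D2].
rewrite -(ler_pM2l s0); nra.
Qed.

Lemma right_derivative_unique f p v L M :
  right_derivative f p v L -> right_derivative f p v M -> L = M.
Proof.
move=> fL fM; apply/eqP; rewrite eq_le; apply/andP; split;
  rewrite -[leRHS]addr0.
  apply: (right_derivative_le fL fM) => e e0; exists 1 => // s /andP[s0 _].
  by rewrite lerDl mulr_ge0 ?add0r ?ltW.
apply: (right_derivative_le fM fL) => e e0; exists 1 => // s /andP[s0 _].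
by rewrite lerDl mulr_ge0 ?add0r ?ltW.
Qed.

Lemma right_derivativeZ f p v L (l : R) : 0 < l ->
  right_derivative f p v L -> right_derivative f p (l *: v) (l * L).
Proof.
move=> l0 fL e e0; have [|h h0 H] := fL (e / l); first by rewrite divr_gt0.
exists (h / l); first by rewrite divr_gt0.
move=> s /andP[s0 sh]; rewrite scalerA mulrA.
rewrite (le_trans (H (s * l) _)) ?mulr_gt0//= -?ltr_pdivlMr//.
by rewrite mulrCA mulrAC -mulrA divff ?mulr1 ?gt_eqF// mulrC.
Qed.

Lemma right_derivative0 f p : right_derivative f p 0 0.
Proof.
move=> e e0; exists 1 => // s /andP[s0 _].
by rewrite scaler0 addr0 subrr mulr0 subr0 normr0 mulr_ge0// ltW.
Qed.

Lemma small_step (v : Y) (r : R) : 0 < r ->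
  exists2 h : R, 0 < h & forall s : R, 0 < s < h -> `|s *: v| < r.
Proof.
move=> r0; have v1 : 0 < `|v| + 1 by rewrite ltr_wpDl.
exists (r / (`|v| + 1)); first by rewrite divr_gt0.
move=> s /andP[s0]; rewrite ltr_pdivlMr// => /(le_lt_trans _); apply.
by rewrite normrZ gtr0_norm// ler_pM2l// lerDl.
Qed.

Section semiconvex.
Variables (f : Y -> R) (p : Y) (r C : R).
Hypotheses (r0 : 0 < r) (C0 : 0 <= C).
Hypotheses (flip : lipschitz_near f p r C) (fsc : semiconvex_near f p r C).

Let pr : `|p - p| < r. Proof. by rewrite subrr normr0. Qed.

(** Up to a multiple of the step, difference quotients are nondecreasing in the
    step; the right derivative is the infimum of the corrected quotients. *)
Lemma semiconvex_right_derivative v : exists L, right_derivative f p v L.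
Proof.
have [h0 h00 Hh0] := small_step v r0.
have [q qs] : exists q : R -> R, forall s : R, 0 < s < h0 ->
    f (p + s *: v) - f p = s * q s.
  exists (fun s => (f (p + s *: v) - f p) / s) => s /andP[s0 _].
  by rewrite mulrCA divff ?mulr1 ?gt_eqF.
pose B := C * `|v| ^+ 2.
have B0 : 0 <= B by rewrite mulr_ge0// exprn_ge0.
have near (s : R) : 0 < s < h0 -> `|p + s *: v - p| < r.
  by move=> /Hh0; rewrite addrC addKr.
have qlip (s : R) : 0 < s < h0 -> - (C * `|v|) <= q s.
  move=> sh; have /andP[s0 _] := sh.
  have := flip (near s sh) pr.
  rewrite qs// [p + _]addrC addrK normrM normrZ (gtr0_norm s0) mulrCA ler_pM2l//.
  by rewrite ler_norml => /andP[].
have qmono (s t : R) : 0 < s -> s <= t -> t < h0 -> q s <= q t + B * t.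
  move=> s0 st th; have t0 : 0 < t := lt_le_trans s0 st.
  have th' : 0 < t < h0 by rewrite t0.
  have sh : 0 < s < h0 by rewrite s0 (le_lt_trans st).
  have t1 : 0 <= s / t <= 1.
    by rewrite ler_pdivrMr// mul1r st andbT divr_ge0 ?(ltW s0) ?(ltW t0).
  have := fsc pr (near t th') t1.
  rewrite [p + t *: v]addrC addrK scalerA divfK ?gt_eqF// [t *: v + p]addrC.
  rewrite (qs t)// => H; have := qs s sh; rewrite -(ler_pM2l s0) => Q.
  have -> : s * (q t + B * t) = s / t * (t * q t) + C * (s / t) * `|t *: v| ^+ 2.
    by rewrite normrZ gtr0_norm// /B; field; rewrite gt_eqF.
  by move: H; rewrite -Q; lra.
pose E := [set q s + B * s | s in [set s | 0 < s < h0]].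
have E0 : has_inf E.
  split; first by exists (q (h0/2) + B * (h0/2)); exists (h0/2) => //=; lra.
  exists (- (C * `|v|)) => _ [s /= sh <-].
  by rewrite (le_trans (qlip s sh))// lerDl mulr_ge0// ltW//; case/andP: sh.
exists (inf E) => e e0.
have [_ [t /= /andP[t0 th] <-] Ht] := inf_adherent e0 E0.
have B1 : 0 < B + 1 by rewrite ltr_wpDl.
exists (Num.min t (e / (B + 1))); first by rewrite lt_min t0 divr_gt0.
move=> s /andP[s0]; rewrite lt_min ltr_pdivlMr// => /andP[st sB].
have sh : 0 < s < h0 by rewrite s0 (lt_trans st).
have H1 := qmono _ _ s0 (ltW st) th.
have H2 : inf E <= q s + B * s by apply: ge_inf; [exact: E0.2|exists s].
rewrite qs// -mulrBr normrM gtr0_norm// mulrC ler_pM2r// ler_norml.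
by apply/andP; split; nra.
Qed.

Lemma right_derivative_lip v w L M :
  right_derivative f p v L -> right_derivative f p w M ->
  L <= M + C * `|v - w|.
Proof.
move=> fL fM; apply: (right_derivative_le fL fM) => e e0.
have [h h0 H] := small_step v r0; have [k k0 K] := small_step w r0.
exists (Num.min h k); first by rewrite lt_min h0.
move=> s /andP[s0]; rewrite lt_min => /andP[sh sk].
have /flip : `|p + s *: v - p| < r by rewrite addrC addKr H// s0.
have K1 : `|p + s *: w - p| < r by rewrite addrC addKr K// s0.
move=> /(_ _ K1); rewrite opprD addrACA subrr add0r -scalerBr normrZ gtr0_norm//.
move=> /(le_trans (ler_norm _)) H2.
have : 0 < e * s by rewrite mulr_gt0.
by move: H2; rewrite mulrDl -mulrA [`|_| * s]mulrC; lra.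
Qed.

(** The point [p + s (u + v)] is the middle of [p + 2 s u] and [p + 2 s v], and
    the semiconvexity error is quadratic in [s]. *)
Lemma right_derivative_subadd u v L M N :
  right_derivative f p u L -> right_derivative f p v M ->
  right_derivative f p (u + v) N -> N <= L + M.
Proof.
move=> fL fM fN.
apply/ler_addgt0Pr => e e0; have e2 : 0 < e / 4 by lra.
have [h0 h00 H0] := fL _ e2; have [h1 h10 H1] := fM _ e2.
have [h2 h20 H2] := fN _ e2.
have [k k0 K] := small_step (2 *: u) r0; have [l l0 Hl] := small_step (2 *: v) r0.
pose B := C * `|v - u| ^+ 2 * 2.
have B0 : 0 <= B by rewrite !mulr_ge0// ?exprn_ge0.
have B1 : 0 < B + 1 by rewrite ltr_wpDl.
have m0 : 0 < Num.min (Num.min (h0 / 2) (h1 / 2))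
             (Num.min h2 (Num.min k (Num.min l (e / 4 / (B + 1))))).
  by rewrite !lt_min !divr_gt0// h20 k0 l0.
have [s s0] : exists2 s : R, 0 < s & s < Num.min (Num.min (h0 / 2) (h1 / 2))
             (Num.min h2 (Num.min k (Num.min l (e / 4 / (B + 1))))).
  by exists (Num.min (Num.min (h0 / 2) (h1 / 2))
             (Num.min h2 (Num.min k (Num.min l (e / 4 / (B + 1))))) / 2); lra.
rewrite !lt_min => /and3P[/andP[sh0 sh1] sh2 /and3P[sk sl sB]].
move: sB; rewrite ltr_pdivlMr// => sB.
have /H0 : 0 < 2 * s < h0 by lra.
have /H1 : 0 < 2 * s < h1 by lra.
have /H2 : 0 < s < h2 by lra.
have nu : `|p + (2 * s) *: u - p| < r.
  by rewrite addrC addKr mulrC -scalerA K// s0.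
have nv : `|p + (2 * s) *: v - p| < r.
  by rewrite addrC addKr mulrC -scalerA Hl// s0.
have t12 : 0 <= (2^-1 : R) <= 1 by lra.
have := fsc nu nv t12.
have -> : p + (2 * s) *: u + 2^-1 *: (p + (2 * s) *: v - (p + (2 * s) *: u))
  = p + s *: (u + v).
  rewrite opprD addrACA subrr add0r -scalerBr scalerA mulrA mulVf ?mul1r//.
  rewrite -addrA; congr (_ + _).
  by rewrite scalerBr mulrDl mul1r scalerDl scalerDr addrA addrAC addrK.
have -> : p + (2 * s) *: v - (p + (2 * s) *: u) = (2 * s) *: (v - u).
  by rewrite opprD addrACA subrr add0r -scalerBr.
rewrite normrZ (gtr0_norm (_ : 0 < 2 * s)); last lra.
rewrite !ler_norml => A /andP[A1 A2] /andP[A3 A4] /andP[A5 A6].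
have A7 : C * 2^-1 * (2 * s * `|v - u|) ^+ 2 = s * (s * B).
  by rewrite /B; field.
move: A; rewrite A7 => A.
have A8 : s * (s * B) <= s * (e / 4) by rewrite ler_pM2l//; nra.
rewrite -(ler_pM2l s0). nra.
Qed.

End semiconvex.

Lemma is_derive_right_derivative f p v L :
  right_derivative f p v L -> right_derivative f p (- v) (- L) ->
  is_derive p v (f : Y -> R^o) L.
Proof.
move=> fL fN.
have H : h^-1 *: (((f : Y -> R^o) \o shift p) (h *: v) - f p) @[h --> 0^'] -->
    (L : R^o).
  apply/cvgrPdist_le => e e0.
  have [h h0 H] := fL _ e0; have [k k0 K] := fN _ e0.
  exists (Num.min h k) => /=; first by rewrite lt_min h0.
  move=> s; rewrite /ball_/= sub0r normrN lt_min => /andP[sh sk] sN0.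
  rewrite -normrN opprB.
  have sv : s^-1 *: (f (s *: v + p) - f p : R^o) - L = s^-1 * (f (p + s *: v) - f p - s * L).
    rewrite mulrBr mulKf// /GRing.scale/=; congr (_ * (f _ - _) - _).
    by rewrite addrC.
  rewrite sv normrM normfV mulrC ler_pdivrMr ?normr_gt0//.
  have [s0|s0] := ltrP 0 s.
    by rewrite (gtr0_norm s0) H// s0 -(gtr0_norm s0).
  have s1 : s < 0 by rewrite lt_neqAle sN0.
  have /K : 0 < `|s| < k by rewrite normr_gt0 sN0.
  by rewrite (ltr0_norm s1) scalerN scaleNr opprK mulrNN.
by split; [apply/cvg_ex; exists L|exact/cvg_lim].
Qed.

(** The sublinear map [L] of right derivatives satisfies [L v + L (- v) >= 0].
    The hypothesis on second differences turns this into an equality for [v] in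
    [D], hence for all [v] by continuity; an odd sublinear map is linear. *)
Lemma semiconvex_gateaux f p (r C : R) (D : set Y) : 0 < r -> 0 <= C ->
  lipschitz_near f p r C -> semiconvex_near f p r C -> dense D ->
  (forall v, D v -> forall e, 0 < e -> exists2 s : R, 0 < s < e &
     f (p + s *: v) + f (p - s *: v) - 2 * f p < e * s) ->
  gateaux_differentiable f p.
Proof.
move=> r0 C0 flip fsc dD fD.
have /choice[L HL] := semiconvex_right_derivative r0 C0 flip fsc.
have Llip v w : L v <= L w + C * `|v - w| :=
  right_derivative_lip r0 flip (HL v) (HL w).
have Lsub v w : L (v + w) <= L v + L w :=
  right_derivative_subadd r0 C0 fsc (HL v) (HL w) (HL (v + w)).
have L0 : L 0 = 0 := right_derivative_unique (HL 0) (right_derivative0 f p).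
have LD v : D v -> L v + L (- v) <= 0.
  move=> Dv; rewrite leNgt; apply/negP => Lpos.
  set eta := L v + L (- v) in Lpos.
  have e4 : 0 < eta / 4 by lra.
  have [h h0 H] := HL v _ e4; have [k k0 K] := HL (- v) _ e4.
  have m0 : 0 < Num.min (Num.min h k) (eta / 2) by rewrite !lt_min h0 k0; lra.
  have [s /andP[s0 sm] Hs] := fD v Dv _ m0.
  move: (sm); rewrite !lt_min => /andP[/andP[sh sk] se].
  have /H : 0 < s < h by rewrite s0.
  have /K : 0 < s < k by rewrite s0.
  rewrite scalerN !ler_norml => /andP[A1 A2] /andP[A3 A4].
  have A5 : Num.min (Num.min h k) (eta / 2) * s <= eta / 2 * s.
    by rewrite ler_pM2r// ge_min lexx orbT.
  have : s * L v + s * L (- v) = s * eta by rewrite -mulrDr.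
  nra.
have Lodd v : L (- v) = - L v.
  apply/eqP; rewrite eq_le; apply/andP; split; last first.
    by rewrite -subr_ge0 opprK -L0 -(subrr v) addrC Lsub.
  rewrite -subr_le0 opprK; apply/ler_addgt0Pr => e e0.
  have C1 : 0 < 2 * C + 1 by rewrite ltr_wpDl// mulr_ge0.
  have eC : 0 < e / (2 * C + 1) by rewrite divr_gt0.
  have [||w [/= wv Dw]] := dD (ball v (e / (2 * C + 1))).
  - by exists v; apply: ballxx.
  - exact: ball_open.
  have := LD w Dw; have := Llip v w; have := Llip (- v) (- w).
  rewrite -opprD normrN.
  move: wv; rewrite -ball_normE /= ltr_pdivlMr// => wv.
  have : 0 <= `|v - w| by []. nra.
have Ladd : {morph L : v w / v + w}.
  move=> v w; apply/eqP; rewrite eq_le Lsub/=.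
  have := Lsub (v + w) (- w); rewrite addrK Lodd. lra.
have LZ a v : L (a *: v) = a * L v.
  have pos l w : 0 < l -> L (l *: w) = l * L w.
    by move=> l0; apply: right_derivative_unique (HL _) (right_derivativeZ l0 (HL w)).
  have [/pos->//|a0|->] := ltrgt0P a.
    by rewrite -[a *: v]opprK -scaleNr Lodd pos ?oppr_gt0// mulNr opprK.
  by rewrite scale0r mul0r.
have Llin : linear (L : Y -> R^o).
  by move=> a v w; rewrite Ladd LZ.
pose LL := HB.pack_for {linear Y -> R^o} (L : Y -> R^o)
  (GRing.isLinear.Build R Y R^o *:%R (L : Y -> R^o) Llin).
exists LL => [|v].
  move=> v; apply/cvgrPdist_lt => e e0.
  have C1 : 0 < C + 1 by rewrite ltr_wpDl.
  apply/nbhs_normP; exists (e / (C + 1)) => /=; first by rewrite divr_gt0.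
  move=> w /=; rewrite ltr_pdivlMr// => vw.
  have := Llip v w; have := Llip w v; rewrite [`|w - v|]distrC.
  have : 0 <= `|v - w| by [].
  by rewrite ltr_norml => *; apply/andP; split; nra.
apply: is_derive_right_derivative (HL v) _.
by rewrite -[- LL v]Lodd; exact: HL.
Qed.

End one_sided_derivative.

(** * Generic differentiability *)

Section generic_differentiability.
Context (R : realType).

(** Otherwise, along the points [p + k s v], the first differences of [f] would
    grow by [e * s] at each step, hence by [N * e * s] after [N] steps, while
    they are bounded by [C * s * |v|]. *)
Lemma second_difference_small (Y : normedModType R) (f : Y -> R) (p v : Y)
    (r C e : R) :
  0 < r -> 0 <= C -> lipschitz_near f p r C -> 0 < e ->
  exists x (s : R), [/\ 0 < s < e, `|x - p| < r, `|x + s *: v - p| < r,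
    `|x - s *: v - p| < r & f (x + s *: v) + f (x - s *: v) - 2 * f x < e * s].
Proof.
move=> r0 C0 flip e0; apply: contrapT => none.
have [h h0 Hh] := small_step v r0.
pose N := (Num.truncn (2 * C * `|v| / e)).+1.
have NB : 2 * C * `|v| < e * N%:R by rewrite -ltr_pdivrMl// mulrC truncnS_gt.
have m0 : 0 < Num.min h e by rewrite lt_min h0.
pose s := Num.min h e / N.+2%:R.
have s0 : 0 < s by rewrite divr_gt0.
have sN : s * N.+2%:R = Num.min h e by rewrite /s divfK.
have close (k : nat) : (k <= N.+1)%N -> `|p + (k%:R * s) *: v - p| < r.
  move=> kN; rewrite [p + _]addrC addrK.
  have [->|k0] := posnP k; first by rewrite mul0r scale0r normr0.
  apply: Hh; rewrite mulr_gt0 ?ltr0n//= (@lt_le_trans _ _ (Num.min h e))//.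
    by rewrite -sN mulrC ltr_pM2l// ltr_nat.
  by rewrite ge_min lexx.
pose a (k : nat) := f (p + (k%:R * s) *: v).
have se : 0 < s < e.
  rewrite s0 (@lt_le_trans _ _ (Num.min h e))// ?ge_min ?lexx ?orbT//.
  by rewrite -sN -[ltLHS]mulr1 ltr_pM2l// ltr1n.
have growth k : (k <= N)%N -> a 1%N - a 0%N + k%:R * (e * s) <= a k.+1 - a k.
  elim: k => [|k IH] kN; first by rewrite mul0r addr0.
  have {}IH := IH (ltnW kN).
  suff : e * s <= a k.+2 + a k - 2 * a k.+1.
    by rewrite -[k.+1%:R]natr1 mulrDl mul1r; lra.
  rewrite leNgt; apply/negP => small; apply: none.
  have plus : p + (k.+1%:R * s) *: v + s *: v = p + (k.+2%:R * s) *: v.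
    by rewrite -[k.+2%:R]natr1 mulrDl mul1r scalerDl addrA.
  have minus : p + (k.+1%:R * s) *: v - s *: v = p + (k%:R * s) *: v.
    by rewrite -[k.+1%:R]natr1 mulrDl mul1r scalerDl addrA addrK.
  exists (p + (k.+1%:R * s) *: v), s; rewrite plus minus; split => //.
  - by apply: close; rewrite ltnS ltnW.
  - by apply: close.
  - by apply: close; rewrite ltnW// ltnS ltnW.
have step k : (k <= N)%N -> `|a k.+1 - a k| <= C * (s * `|v|).
  move=> kN; apply: le_trans (flip _ _ (close _ _) (close _ _)) _ => //.
    by rewrite leqW.
  rewrite opprD addrACA subrr add0r -scalerBl -mulrBl -natrB// subSnn mul1r.
  by rewrite normrZ gtr0_norm.
have := growth N (leqnn _); have := step N (leqnn _); have := step 0%N isT.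
rewrite !ler_norml => /andP[A1 A2] /andP[A3 A4] A5.
have : s * (e * N%:R) <= s * (2 * C * `|v|) by lra.
by rewrite ler_pM2l// leNgt NB.
Qed.

Lemma lipschitz_near_continuous (Y : normedModType R) (f : Y -> R) (p : Y)
    (r C : R) : 0 < r -> 0 <= C -> lipschitz_near f p r C ->
  {for p, continuous f}.
Proof.
move=> r0 C0 flip; apply/cvgrPdist_lt => e e0.
have C1 : 0 < C + 1 by rewrite ltr_wpDl.
apply/nbhs_normP; exists (Num.min r (e / (C + 1))) => /=.
  by rewrite lt_min r0 divr_gt0.
move=> w /=; rewrite lt_min ltr_pdivlMr// => /andP[pr pe].
have := flip p w; rewrite subrr normr0 [`|w - p|]distrC => /(_ r0 pr).
move=> /le_lt_trans; apply; rewrite (le_lt_trans _ pe)// mulrC ler_wpM2l//.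
by rewrite lerDl.
Qed.

(** Adding the exterior of [U] to each [F n] makes it dense in the whole
    space. *)
Lemma Baire_open (Y : completeNormedModType R) (U : set Y) (F : (set Y)^nat) :
  open U -> (forall n, open (F n)) -> (forall n, F n `<=` U) ->
  (forall n, U `<=` closure (F n)) -> dense_Gdelta_in U (\bigcap_n F n).
Proof.
move=> oU oF FU Fd; split; first by exists F.
  by move=> x /(_ 0%N I)/FU.
have : forall n, open (F n `|` ~` closure U) /\ dense (F n `|` ~` closure U).
  move=> n; split.
    by apply: openU => //; apply: closed_openC; exact: closed_closure.
  move=> W [w Ww] oW; have [[p [Wp Up]]|WU] := pselect (W `&` U !=set0).
    have [y [Fy Wy]] := Fd n p Up W (open_nbhs_nbhs (conj oW Wp)).
    by exists y; split => //; left.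
  exists w; split=> //; right => cw; apply: WU.
  have [y [Uy Wy]] := cw W (open_nbhs_nbhs (conj oW Ww)).
  by exists y.
move=> /Baire dG p Up B /(nbhs_interior) Bp.
have [||y [[Uy By] Gy]] := dG (U `&` interior B).
- by exists p; split => //; exact: nbhs_singleton.
- by apply: openI => //; exact: open_interior.
exists y; split; last exact: interior_subset.
by move=> n _; have [//|] := Gy n I; case; exact: subset_closure.
Qed.

(** With [O v m] the set of points where the second difference in the direction
    [v] is smaller than [s / (m + 1)] for some step [s < 1 / (m + 1)], the
    dense G-delta set is the intersection of the [O v m] for [v] in the
    countable dense set; [e] enumerates the directions, and pairs [(i, m)] are
    encoded as natural numbers. *)
Theorem generic_gateaux (Y : completeNormedModType R) (U : set Y)
    (f : Y -> R) : separable Y -> open U ->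
  (forall p, U p -> exists r C : R,
     [/\ 0 < r, 0 <= C, lipschitz_near f p r C & semiconvex_near f p r C]) ->
  exists2 G, dense_Gdelta_in U G & forall p, G p -> gateaux_differentiable f p.
Proof.
move=> [D /countable_injP[g ginj] dD] oU Hf.
pose O v (m : nat) := [set x | U x /\ exists s : R,
  [/\ 0 < s < m.+1%:R^-1, U (x + s *: v), U (x - s *: v) &
      f (x + s *: v) + f (x - s *: v) - 2 * f x < m.+1%:R^-1 * s]].
have fC x : U x -> {for x, continuous f}.
  by move=> /Hf[r [C [r0 C0 flip _]]]; exact: lipschitz_near_continuous flip.
have oO v m : open (O v m).
  rewrite openE => x [Ux [s [s0 Up Um Hs]]]; rewrite /interior.
  have cp : y + s *: v @[y --> x] --> x + s *: v by apply: cvgD; [exact: cvg_id|exact: cvg_cst].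
  have cm : y - s *: v @[y --> x] --> x - s *: v by apply: cvgB; [exact: cvg_id|exact: cvg_cst].
  have cF : f (y + s *: v) + f (y - s *: v) - 2 * f y @[y --> x] -->
            f (x + s *: v) + f (x - s *: v) - 2 * f x.
    apply: cvgB; last by apply: cvgM; [exact: cvg_cst|exact: fC].
    by apply: cvgD; [exact: cvg_comp cp (fC _ Up)|exact: cvg_comp cm (fC _ Um)].
  near=> y; split; first by near: y; exact: open_nbhs_nbhs.
  exists s; split => //.
  - by near: y; apply: cp; exact: open_nbhs_nbhs.
  - by near: y; apply: cm; exact: open_nbhs_nbhs.
  - by near: y; exact: (cvgr_lt _ cF).
have dO v m : U `<=` closure (O v m).
  move=> p Up B /nbhs_normP[d /= d0 Bd].
  have /nbhs_normP[u /= u0 Uu] : nbhs p U by exact: open_nbhs_nbhs.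
  have [r [C [r0 C0 flip _]]] := Hf p Up.
  pose q := Num.min r (Num.min u d).
  have q0 : 0 < q by rewrite !lt_min r0 u0.
  have [qr qu qd] : [/\ q <= r, q <= u & q <= d].
    by rewrite /q !ge_min !lexx !orbT.
  have {}flip : lipschitz_near f p q C.
    by move=> a b aq bq; apply: flip; [exact: lt_le_trans aq _|exact: lt_le_trans bq _].
  have inU y : `|y - p| < q -> U y.
    by rewrite distrC => yq; apply: Uu => /=; exact: lt_le_trans yq qu.
  have m0 : 0 < m.+1%:R^-1 :> R by rewrite invr_gt0.
  have [x [s [s0 xq xp xm Hs]]] := second_difference_small v q0 C0 flip m0.
  exists x; split; last by apply: Bd => /=; rewrite distrC (lt_le_trans xq).
  by split; [exact: inU|exists s; split => //; exact: inU].
pose e i := xget 0 [set v | D v /\ g v = i].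
have eg v : D v -> e (g v) = v.
  move=> Dv; rewrite /e; case: xgetP => [w -> [Dw gw]|/(_ v)[]//].
  by apply: ginj; rewrite ?inE.
pose F (n : nat) := if unpickle n is Some (i, m) then O (e i) m else O 0 0%N.
exists (\bigcap_n F n).
  apply: Baire_open => // n; rewrite /F; case: unpickle => [[i m]|] //.
    by move=> x [].
  by move=> x [].
move=> p Gp; have Up : U p by have := Gp (pickle (0%N, 0%N)) I; rewrite /F pickleK => -[].
have [r [C [r0 C0 flip fsc]]] := Hf p Up.
apply: (semiconvex_gateaux r0 C0 flip fsc dD) => v Dv d d0.
pose m := Num.truncn d^-1.
have md : m.+1%:R^-1 < d.
  by rewrite -[d]invrK ltf_pV2 ?posrE ?invr_gt0// truncnS_gt.
have := Gp (pickle (g v, m)) I; rewrite /F pickleK eg// => -[_ [s [s0 _ _ Hs]]].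
have /andP[s1 s2] := s0.
exists s; first by rewrite s1 (lt_trans s2).
by rewrite (lt_le_trans Hs)// ler_pM2r// ltW.
Unshelve. all: by end_near. Qed.

End generic_differentiability.
(** * Products of Banach spaces *)

(* Declared anew so that products of Banach spaces receive the common
   substructures of pointed and of uniform spaces. *)
HB.instance Definition _ (R : realType) (U V : completeNormedModType R) :=
  Pointed.on (U * V)%type.

Lemma prod_complete (R : realType) (U V : completeNormedModType R)
    (F : set_system (U * V)%type) :
  ProperFilter F -> cauchy F -> cvg F.
Proof.
move=> PF /cauchyP cF.
have /cauchy_cvg/cvg_ex[a Fa] : cauchy (fst @ F).
  apply: cauchy_exP => e e0; have [x Fx] := cF e e0.
  exists x.1; suff sub : ball x e `<=` fst @^-1` ball x.1 e by exact: filterS sub Fx.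
  by move=> y -[].
have /cauchy_cvg/cvg_ex[b Fb] : cauchy (snd @ F).
  apply: cauchy_exP => e e0; have [x Fx] := cF e e0.
  exists x.2; suff sub : ball x e `<=` snd @^-1` ball x.2 e by exact: filterS sub Fx.
  by move=> y -[].
apply/cvg_ex; exists (a, b).
move=> A [[P Q] /= [Pa Qb] PQ].
have FP : F (fst @^-1` P) := Fa P Pa; have FQ : F (snd @^-1` Q) := Fb Q Qb.
by apply: filterS2 FP FQ => -[x y] Px Qy; exact: PQ.
Qed.

HB.instance Definition _ (R : realType) (U V : completeNormedModType R) :=
  Uniform_isComplete.Build (U * V)%type (@prod_complete R U V).

Lemma separable_prod (U V : topologicalType) :
  separable U -> separable V -> separable (U * V)%type.
Proof.
move=> [D cD dD] [E cE dE]; exists (D `*` E); first exact: countableX.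
move=> O [[p q] Opq] oO.
have [[A B] /= [pA qB] AB] := open_nbhs_nbhs (conj oO Opq).
have [||d [Ad Dd]] := dD (interior A); first by exists p.
  exact: open_interior.
have [||e [Be Ee]] := dE (interior B); first by exists q.
  exact: open_interior.
exists (d, e); split=> //; apply: AB; split => /=; exact: interior_subset.
Qed.

(** * Distance to the boundary *)

Section distance.
Context (R : realType) (X : normedModType R).
Implicit Types (x y z : X) (A : set X).

Lemma set_dist_le x A a : A a -> set_dist x A <= `|x - a|.
Proof.
by move=> Aa; apply: ge_inf; [exists 0 => _ [b _ <-]|exists a].
Qed.

Lemma set_dist_ge x A (c : R) : A !=set0 ->
  (forall a, A a -> c <= `|x - a|) -> c <= set_dist x A.
Proof.
move=> [a Aa] H; apply: lb_le_inf; first by exists `|x - a|; exists a.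
by move=> _ [b Ab <-]; exact: H.
Qed.

Lemma set_dist_lip x y A : A !=set0 -> set_dist x A <= set_dist y A + `|x - y|.
Proof.
move=> A0; rewrite -lerBlDr; apply: set_dist_ge => // a Aa; rewrite lerBlDr.
by rewrite (le_trans (set_dist_le x Aa))// [leRHS]addrC -[x - a](subrKA y) ler_normD.
Qed.

Variable Omega : set X.
Hypotheses (Oopen : open Omega) (Obound : boundary Omega !=set0).
Let d z := set_dist z (boundary Omega).

Lemma boundary_notin a : boundary Omega a -> ~ Omega a.
Proof. by move=> [_ +] Oa; apply; exact: open_nbhs_nbhs. Qed.

Lemma boundary_dist_gt0 x : Omega x -> 0 < d x.
Proof.
move=> Ox; have /nbhs_normP[e /= e0 eO] : nbhs x Omega by exact: open_nbhs_nbhs.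
apply: (lt_le_trans e0); apply: set_dist_ge => // a /boundary_notin Oa.
by rewrite leNgt; apply/negP => /eO.
Qed.

(** A segment that leaves the domain crosses its boundary. *)
Lemma ball_boundary_dist x u : Omega x -> `|u - x| < d x -> Omega u.
Proof.
move=> Ox ux; apply: contrapT => Ou.
pose T := [set t : R | 0 <= t <= 1 /\ Omega (x + t *: (u - x))].
have T0 : T 0 by split; rewrite ?scale0r ?addr0// lexx ler01.
have supT : has_sup T by split; [exists 0|exists 1 => t [/andP[]]].
have t01 : 0 <= sup T <= 1.
  by rewrite ub_le_sup//=; [apply: ge_sup => [|t [/andP[]]//]; exists 0|exact: supT.2].
pose p := x + sup T *: (u - x).
have cont : (fun t : R => x + t *: (u - x)) t @[t --> sup T] --> p.
  by apply: cvgD; [exact: cvg_cst|apply: cvgZr_tmp; exact: cvg_id].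
have clp : closure Omega p.
  move=> B Bp; have /nbhs_normP[e /= e0 eB] := cont _ Bp.
  have [t [t1 Ot] te] := sup_adherent e0 supT.
  exists (x + t *: (u - x)); split => //; apply: eB => /=.
  rewrite ger0_norm ?subr_ge0 ?ub_le_sup//; last exact: supT.2.
  by rewrite ltrBlDr -ltrBlDl.
have nOp : ~ Omega p.
  move=> Op; have /nbhs_normP[e /= e0 eO] := cont _ (open_nbhs_nbhs (conj Oopen Op)).
  have := t01; rewrite [sup T <= 1]le_eqVlt => /andP[t0 /orP[/eqP t1|t1]].
    by apply: Ou; move: Op; rewrite /p t1 scale1r addrC subrK.
  pose t := Num.min 1 (sup T + e / 2).
  have tT : sup T < t by rewrite lt_min t1 ltrDl; lra.
  have te : t <= sup T + e / 2 by rewrite ge_min lexx orbT.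
  have : T t.
    split; first by rewrite (le_trans t0 (ltW tT)) ge_min lexx.
    by apply: eO => /=; rewrite ltr0_norm ?subr_lt0//; lra.
  by move=> /(ub_le_sup supT.2); rewrite leNgt tT.
have bp : boundary Omega p by split => // /interior_subset.
have := set_dist_le x bp; rewrite leNgt => /negP; apply.
rewrite /p opprD addNKr normrN normrZ ger0_norm; last by case/andP: t01.
by rewrite (le_lt_trans _ ux)// ler_piMl//; case/andP: t01.
Qed.

Hypothesis Oconvex : convex_set Omega.

Lemma domain_convex x y (t : R) : Omega x -> Omega y -> 0 <= t <= 1 ->
  Omega (x + t *: (y - x)).
Proof.
move=> Ox Oy t01.
have /andP[t0 t1] := t01.
have := @Oconvex y x (Itv01 t0 t1).
rewrite !inE => /(_ Oy Ox).
suff -> : conv (Itv01 t0 t1) (y : convex_lmodType X) x = x + t *: (y - x) by [].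
rewrite /conv/= scalerBr scalerBl scale1r addrCA.
by [].
Qed.

(** The domain contains the open balls of radii [d x] around [x] and [d y]
    around [y], hence their convex combination, which is the ball of radius
    [d x + t * (d y - d x)] around [x + t *: (y - x)]. *)
Lemma boundary_dist_concave x y (t : R) : Omega x -> Omega y -> 0 <= t <= 1 ->
  d x + t * (d y - d x) <= d (x + t *: (y - x)).
Proof.
move=> Ox Oy t01; apply: set_dist_ge => // a /boundary_notin Oa.
rewrite leNgt; apply/negP => lt; apply: Oa.
have dx := boundary_dist_gt0 Ox; have dy := boundary_dist_gt0 Oy.
set D := d x + t * (d y - d x) in lt.
have D0 : 0 < D by rewrite /D; move: t01 => /andP[]; nra.
pose w := D^-1 *: (a - (x + t *: (y - x))).
have w1 : `|w| < 1.
  by rewrite normrZ gtr0_norm ?invr_gt0// mulrC ltr_pdivrMr// mul1r distrC.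
have Ox' : Omega (x + d x *: w).
  apply: (ball_boundary_dist Ox).
  by rewrite [_ + _ *: w]addrC addrK normrZ gtr0_norm// -[ltRHS]mulr1 ltr_pM2l.
have Oy' : Omega (y + d y *: w).
  apply: (ball_boundary_dist Oy).
  by rewrite [_ + _ *: w]addrC addrK normrZ gtr0_norm// -[ltRHS]mulr1 ltr_pM2l.
have := domain_convex Ox' Oy' t01.
suff -> : x + d x *: w + t *: (y + d y *: w - (x + d x *: w)) = a by [].
have -> : y + d y *: w - (x + d x *: w) = (y - x) + (d y - d x) *: w.
  by rewrite opprD addrACA scalerBl.
rewrite scalerDr scalerA addrACA -scalerDl -/D.
by rewrite /w scalerA divff ?gt_eqF// scale1r addrC subrK.
Qed.

End distance.

(** * Path length and arc length *)

Section path_length.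
Context (R : realType) (X : normedModType R) (gamma : R -> X).
Implicit Types (a b c t : R) (s : seq R).

Lemma variation_sum_nil a b : variation_sum a b gamma [::] = 0.
Proof. by rewrite /variation_sum big_nil. Qed.

Lemma variation_sum_cons a b t s : variation_sum a b gamma (t :: s) =
  `|gamma t - gamma a| + variation_sum t b gamma s.
Proof. by rewrite /variation_sum/= big_nat_recl. Qed.

Lemma variation_sum_cat a b c s1 s2 : variation_sum a c gamma (s1 ++ s2) =
  variation_sum a b gamma s1 + variation_sum (last a s1) c gamma s2.
Proof.
elim: s1 a => [|t s1 IH] a /=; first by rewrite variation_sum_nil add0r.
by rewrite !variation_sum_cons IH addrA.
Qed.

Lemma variation_sum_le_path_length a b s : itv_partition a b s ->
  ((variation_sum a b gamma s)%:E <= path_length a b gamma)%E.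
Proof. by move=> abs; apply: ereal_sup_ubound; exists s. Qed.

Lemma path_length_le a b (l : \bar R) :
  (forall s, itv_partition a b s -> ((variation_sum a b gamma s)%:E <= l)%E) ->
  (path_length a b gamma <= l)%E.
Proof. by move=> H; apply: ge_ereal_sup => _ [s /H ? <-]. Qed.

Lemma path_length_gtP a b c : (c%:E < path_length a b gamma)%E ->
  exists2 s, itv_partition a b s & c < variation_sum a b gamma s.
Proof.
move=> /ereal_sup_gt[_ [s abs <-]]; rewrite lte_fin => cs.
by exists s.
Qed.

Lemma norm_le_path_length a b : a <= b ->
  (`|gamma b - gamma a|%:E <= path_length a b gamma)%E.
Proof.
rewrite le_eqVlt => /predU1P[<-|ab].
  rewrite subrr normr0 -(variation_sum_nil a a).
  exact: variation_sum_le_path_length.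
apply: le_trans (variation_sum_le_path_length (itv_partition1 ab)).
by rewrite variation_sum_cons variation_sum_nil addr0.
Qed.

Lemma path_length_ge0 a b : a <= b -> (0 <= path_length a b gamma)%E.
Proof. by move=> /norm_le_path_length; apply: le_trans; rewrite lee_fin. Qed.

(** Inserting [b] in a partition of [[a, c]] does not decrease the variation,
    by the triangle inequality. *)
Lemma path_length_subadd a b c : a <= b -> b <= c ->
  (path_length a c gamma <= path_length a b gamma + path_length b c gamma)%E.
Proof.
move=> ab bc; apply: path_length_le => s.
elim: s a ab => [|t s IH] a ab acs.
  by rewrite variation_sum_nil adde_ge0// path_length_ge0.
rewrite variation_sum_cons EFinD.
have tcs := itv_partition_cons acs.
have at_ : a < t by case: acs => /= /andP[].
have [tb|bt] := leP t b.
  apply: (@le_trans _ _ (`|gamma t - gamma a|%:E +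
     (path_length t b gamma + path_length b c gamma))%E).
    by rewrite leeD2l// IH.
  rewrite addeA leeD2r// -leeBrDl//; apply: path_length_le => r tbr.
  rewrite leeBrDl// -EFinD -variation_sum_cons.
  by apply: variation_sum_le_path_length; case: tbr => p l; split => //=; rewrite at_.
apply: (@le_trans _ _ (`|gamma b - gamma a|%:E + (`|gamma t - gamma b|%:E +
    (variation_sum t c gamma s)%:E))%E).
  rewrite -!EFinD lee_fin addrA lerD2r.
  by rewrite addrC -(subrKA (gamma b) (gamma t)) ler_normD.
apply: leeD; first exact: norm_le_path_length.
rewrite -EFinD -variation_sum_cons.
by apply: variation_sum_le_path_length; case: tcs => p l; split => //=; rewrite bt.
Qed.

Lemma path_length_superadd a b c : a <= b -> b <= c ->
  (path_length a b gamma + path_length b c gamma <= path_length a c gamma)%E.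
Proof.
move=> ab bc; have [->|] := eqVneq (path_length a c gamma) +oo%E.
  by rewrite leey.
rewrite -ltey => fin.
have acf : path_length a c gamma \is a fin_num.
  by rewrite ge0_fin_numE// path_length_ge0// (le_trans ab).
have key s2 : itv_partition b c s2 ->
    (path_length a b gamma + (variation_sum b c gamma s2)%:E
      <= path_length a c gamma)%E.
  move=> bcs; rewrite -leeBrDr//; apply: path_length_le => s1 abs.
  rewrite leeBrDr// -EFinD.
  have e : last a s1 = b by case: abs => _ /eqP.
  rewrite -[X in variation_sum X c]e -variation_sum_cat.
  by apply: variation_sum_le_path_length; exact: itv_partition_cat abs bcs.
have abf : path_length a b gamma \is a fin_num.
  rewrite ge0_fin_numE ?path_length_ge0//; apply: le_lt_trans fin.
  move: bc; rewrite le_eqVlt => /predU1P[->//|bc].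
  apply: le_trans (key _ (itv_partition1 bc)).
  by rewrite leeDl// lee_fin variation_sum_cons variation_sum_nil addr0.
rewrite -leeBrDl//; apply: path_length_le => s2 /key.
by rewrite leeBrDl.
Qed.

Lemma path_lengthD a b c : a <= b -> b <= c ->
  path_length a c gamma = (path_length a b gamma + path_length b c gamma)%E.
Proof.
move=> ab bc; apply/eqP; rewrite eq_le path_length_subadd//=.
exact: path_length_superadd.
Qed.

End path_length.

Section arc_length.
Context (R : realType) (X : normedModType R) (gamma : R -> X).
Hypotheses (gcont : {within `[0, 1], continuous gamma})
  (grect : rectifiable gamma).
Let l := fine (path_length 0 1 gamma).

Lemma rectifiable_fin : path_length 0 1 gamma = l%:E.
Proof. by rewrite fineK// ge0_fin_numE// path_length_ge0. Qed.

Lemma path_length_fin_num a b : 0 <= a -> a <= b -> b <= 1 ->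
  path_length a b gamma \is a fin_num.
Proof.
move=> a0 ab b1; rewrite ge0_fin_numE ?path_length_ge0//.
apply: le_lt_trans grect.
rewrite (path_lengthD _ a0 (le_trans ab b1)) (path_lengthD _ ab b1).
rewrite addeCA -[leLHS]adde0 leeD2l//.
by rewrite adde_ge0// path_length_ge0.
Qed.

Lemma within_continuousP (t e : R) : 0 <= t <= 1 -> 0 < e ->
  exists2 d : R, 0 < d & forall t' : R, 0 <= t' <= 1 -> `|t - t'| < d ->
    `|gamma t - gamma t'| < e.
Proof.
move=> t01 e0.
have tin : (`[0, 1]%classic : set R) t by rewrite /= in_itv.
have /cvgrPdist_lt/(_ _ e0) := @gcont t.
rewrite /prop_near1 {2}/nbhs/= -nbhs_subspace_in// => /nbhs_normP[d /= d0 H]; exists d => // t' t'01 tt'.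
by apply: H => //=; rewrite in_itv.
Qed.

(** The arc length function has no jumps: it is lower semicontinuous, being a
    supremum of continuous functions, and so is its complement to the total
    length, which is the length of the remaining part of the curve. *)
Lemma path_length_surj (s : R) : 0 <= s <= l ->
  exists2 t : R, 0 <= t <= 1 & path_length 0 t gamma = s%:E.
Proof.
move=> /andP[s0 sl].
pose T := [set t : R | 0 <= t <= 1 /\ (path_length 0 t gamma <= s%:E)%E].
have T0 : T 0.
  split; first by rewrite lexx ler01.
  apply: path_length_le => r /itv_partitionxx ->.
  by rewrite variation_sum_nil lee_fin.
have supT : has_sup T by split; [exists 0|exists 1 => t [/andP[]]].
set u := sup T.
have u01 : 0 <= u <= 1.
  by rewrite ub_le_sup//=; [apply: ge_sup => [|t [/andP[]]//]; exists 0|exact: supT.2].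
have /andP[u0 u1] := u01.
exists u => //; apply/eqP; rewrite eq_le; apply/andP; split.
  rewrite leNgt; apply/negP => /path_length_gtP[r].
  case/lastP: r => [|r w] [pr /eqP]; rewrite ?variation_sum_nil ?ltNge ?s0//.
  rewrite last_rcons => wu; subst w; rewrite -ltNge.
  rewrite -cats1 (variation_sum_cat _ _ 0).
  rewrite variation_sum_cons variation_sum_nil addr0 => sr.
  move: pr; rewrite rcons_path => /andP[pr ru].
  set v := last 0 r in sr ru.
  have e0 : 0 < variation_sum 0 0 gamma r + `|gamma u - gamma v| - s by lra.
  have [d d0 Hd] := within_continuousP u01 e0.
  have ep : 0 < Num.min d (u - v) by rewrite lt_min d0 subr_gt0.
  have [t [t01 Ht] ut] := sup_adherent ep supT.
  have tu : t <= u by apply: ub_le_sup => //; exact: supT.2.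
  have m1 : Num.min d (u - v) <= d by rewrite ge_min lexx.
  have m2 : Num.min d (u - v) <= u - v by rewrite ge_min lexx orbT.
  rewrite -/u in ut.
  have vt : v < t by lra.
  have /(Hd _ t01) : `|u - t| < d by rewrite ger0_norm; lra.
  have : itv_partition 0 t (rcons r t).
    by split; rewrite ?last_rcons// rcons_path pr.
  move/(@variation_sum_le_path_length _ _ gamma) => /le_trans/(_ Ht).
  rewrite -cats1 (variation_sum_cat _ _ 0) lee_fin.
  rewrite variation_sum_cons variation_sum_nil addr0 -/v.
  have : `|gamma u - gamma v| <= `|gamma u - gamma t| + `|gamma t - gamma v|.
    by rewrite -(subrKA (gamma t) (gamma u)) ler_normD.
  lra.
rewrite leNgt; apply/negP => us.
have [u1E|u1N] := eqVneq u 1.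
  by move: us; rewrite u1E rectifiable_fin lte_fin ltNge sl.
have ult1 : u < 1 by rewrite lt_neqAle u1N.
have fu := path_length_fin_num (lexx 0) u0 u1.
have fu1 := path_length_fin_num u0 u1 (lexx 1).
have D := path_lengthD gamma u0 u1; rewrite rectifiable_fin in D.
have : ((l - s)%:E < path_length u 1 gamma)%E.
  move: D us; rewrite -(fineK fu) -(fineK fu1) -EFinD !lte_fin => -[->].
  by rewrite ltrBlDr addrC ltrD2l.
move/path_length_gtP => [[|x r] [pr lr]].
  by move: lr => /= /eqP lr; rewrite -lr ltxx in ult1.
rewrite variation_sum_cons => lsr.
move: pr => /= /andP[ux pr].
have e0 : 0 < `|gamma x - gamma u| + variation_sum x 1 gamma r - (l - s) by lra.
have [d d0 Hd] := within_continuousP u01 e0.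
have x1 : x <= 1 by apply: (@itv_partition_le _ _ _ _ r); split.
pose t := u + Num.min d (x - u) / 2.
have ep : 0 < Num.min d (x - u) by rewrite lt_min d0 subr_gt0.
have m1 : Num.min d (x - u) <= d by rewrite ge_min lexx.
have m2 : Num.min d (x - u) <= x - u by rewrite ge_min lexx orbT.
have ut : u < t by rewrite /t; lra.
have tx : t < x by rewrite /t; lra.
have t0 : 0 <= t by lra.
have t1 : t <= 1 by lra.
have t01 : 0 <= t <= 1 by rewrite t0.
have /(Hd _ t01) gd : `|u - t| < d by rewrite distrC gtr0_norm /t; lra.
have : itv_partition t 1 (x :: r) by split => //=; rewrite tx.
move/(@variation_sum_le_path_length _ _ gamma); rewrite variation_sum_cons => B.
have ft := path_length_fin_num (lexx 0) t0 t1.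
have ft1 := path_length_fin_num t0 t1 (lexx 1).
have D' := path_lengthD gamma t0 t1; rewrite rectifiable_fin in D'.
have : T t.
  split => //; move: D' B; rewrite -(fineK ft) -(fineK ft1) -EFinD !lee_fin => -[lE].
  have : `|gamma x - gamma u| <= `|gamma x - gamma t| + `|gamma t - gamma u|.
    by rewrite -(subrKA (gamma t) (gamma x)) ler_normD.
  by move: gd; rewrite [`|gamma t - _|]distrC; lra.
by move=> /(ub_le_sup supT.2); rewrite -/u leNgt ut.
Qed.

Lemma arc_paramP (s : R) : 0 <= s <= l -> exists t : R,
  [/\ 0 <= t <= 1, path_length 0 t gamma = s%:E & arc_param gamma s = gamma t].
Proof.
move=> /path_length_surj[t t01 ts].
have [] : [set u : R | u \in `[0, 1] /\ path_length 0 u gamma = s%:E]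
    (xget 0 [set u : R | u \in `[0, 1] /\ path_length 0 u gamma = s%:E]).
  by apply: xgetPex; exists t; rewrite /= in_itv.
by rewrite in_itv /= => u01 us; eexists; split; [exact: u01|exact: us|].
Qed.

Lemma arc_param_lip (s s' : R) : 0 <= s -> s <= s' -> s' <= l ->
  `|arc_param gamma s' - arc_param gamma s| <= s' - s.
Proof.
move=> s0 ss' s'l.
have /arc_paramP[t [/andP[t0 t1] ts ->]] : 0 <= s <= l by rewrite s0 (le_trans ss').
have /arc_paramP[t' [/andP[t'0 t'1] ts' ->]] : 0 <= s' <= l by rewrite s'l (le_trans s0).
have [tt|tt] := leP t t'.
  have := norm_le_path_length gamma tt; rewrite -lee_fin => /le_trans; apply.
  move: (path_lengthD gamma t0 tt); rewrite ts ts'.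
  rewrite -(fineK (path_length_fin_num t0 tt t'1)) -EFinD => -[->].
  by rewrite addrC addKr.
have := norm_le_path_length gamma (ltW tt); rewrite -lee_fin distrC.
move: (path_lengthD gamma t'0 (ltW tt)); rewrite ts ts'.
rewrite -(fineK (path_length_fin_num t'0 (ltW tt) t1)) -EFinD => -[sE].
by move: ss'; rewrite !lee_fin; lra.
Qed.

Lemma arc_param0 : arc_param gamma 0 = gamma 0.
Proof.
have l0 : 0 <= l by rewrite -lee_fin -rectifiable_fin path_length_ge0.
have /arc_paramP[t [/andP[t0 t1] ts ->]] : 0 <= (0 : R) <= l by rewrite lexx.
have := norm_le_path_length gamma t0; rewrite ts lee_fin normr_le0.
by rewrite subr_eq0 => /eqP.
Qed.

Lemma arc_param1 : arc_param gamma l = gamma 1.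
Proof.
have l0 : 0 <= l by rewrite -lee_fin -rectifiable_fin path_length_ge0.
have /arc_paramP[t [/andP[t0 t1] ts ->]] : 0 <= l <= l by rewrite lexx l0.
have := norm_le_path_length gamma t1.
move: (path_lengthD gamma t0 t1); rewrite rectifiable_fin ts.
rewrite -(fineK (path_length_fin_num t0 t1 (lexx 1))) -EFinD => -[lE].
have -> : fine (path_length t 1 gamma) = 0 by move: lE; lra.
by rewrite lee_fin normr_le0 subr_eq0 => /eqP.
Qed.

End arc_length.

(** * Integrals of continuous functions over intervals *)

Section interval_integral.
Context (R : realType) (phi : R -> R).
Hypotheses (phic : continuous phi) (phi0 : forall s, 0 <= phi s).
Implicit Types a b c : R.

Let J a b := (\int[lebesgue_measure]_(s in `[a, b]) (phi s)%:E)%E.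

Let mphi (D : set R) : measurable_fun D (EFin \o phi).
Proof.
apply/measurable_EFinP; apply: (@measurable_funS _ _ _ _ setT) => //.
exact: continuous_measurable_fun.
Qed.

Lemma integral_itvD a b c : a <= b -> b <= c -> J a c = (J a b + J b c)%E.
Proof.
move=> ab bc; rewrite /J.
have -> : `[a, c]%classic = `[a, b]%classic `|` `]b, c]%classic.
  by rewrite -itv_bndbnd_setU// bnd_simp.
have <- : (\int[lebesgue_measure]_(s in `]b, c]) (phi s)%:E =
    \int[lebesgue_measure]_(s in `[b, c]) (phi s)%:E)%E.
  by apply: (@integral_itv_obnd_cbnd _ b (BRight c) (EFin \o phi)); exact: mphi.
rewrite ge0_integral_setU//=.
- exact: mphi.
- by move=> s _; rewrite lee_fin.
- apply/disj_setPS => s /= []; rewrite !in_itv/= => /andP[_ sb] /andP[bs _].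
  by move: bs; rewrite ltNge sb.
Qed.
Lemma integral_itv_cst (c a b : R) : a <= b ->
  (\int[lebesgue_measure]_(s in `[a, b]) (cst c%:E) s = (c * (b - a))%:E)%E.
Proof.
move=> ab; rewrite integral_cst//= lebesgue_measure_itv/=.
case: ifP; first by rewrite EFinM EFinB.
rewrite lte_fin ltNge => /negbFE ba.
by rewrite mule0 (_ : a = b) ?subrr ?mulr0//; apply/eqP; rewrite eq_le ab.
Qed.

Lemma integral_itv_le (c a b : R) : a <= b ->
  (forall s, a <= s <= b -> phi s <= c) -> (J a b <= (c * (b - a))%:E)%E.
Proof.
move=> ab H; rewrite -integral_itv_cst//; apply: ge0_le_integral => //=.
- by move=> x _; rewrite lee_fin.
- exact: mphi.
Qed.

Lemma integral_itv_ge (c a b : R) : a <= b -> 0 <= c ->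
  (forall s, a <= s <= b -> c <= phi s) -> ((c * (b - a))%:E <= J a b)%E.
Proof.
move=> ab c0 H; rewrite -integral_itv_cst//; apply: ge0_le_integral => //=.
exact: mphi.
Qed.

End interval_integral.

Section inverse_integral.
Context (R : realType) (h : R -> R).
Hypotheses (h_gt0 : forall s, 0 < h s)
  (h_lip : forall s t, `|h s - h t| <= `|s - t|).

Lemma lipschitz1_continuous (f : R -> R) :
  (forall s t, `|f s - f t| <= `|s - t|) -> continuous f.
Proof.
move=> flip x; apply/cvgrPdist_lt => e e0; apply/nbhs_normP.
by exists e => //= y; exact: le_lt_trans.
Qed.

Lemma inv_continuous : continuous (fun s => (h s)^-1).
Proof.
move=> s; apply: cvgV; first by rewrite gt_eqF.
exact: lipschitz1_continuous.
Qed.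

Lemma inv_ge0 s : 0 <= (h s)^-1.
Proof. by rewrite invr_ge0 ltW. Qed.

(** The steps have the relative size [th], until [l] is reached. Along a step
    from [s], [h] is at most [(1 + th) * h s], so that the step contributes at
    least [th / (1 + th)] to the integral of [1 / h]; this bounds the number of
    steps. *)
Lemma greedy_partition (l th : R) (N : nat) : 0 <= l -> 0 < th ->
  (\int[lebesgue_measure]_(s in `[0%R, l]) (h s)^-1%:E
     < (N%:R * (th / (1 + th)))%:E)%E ->
  exists sigma : nat -> R, [/\ sigma 0%N = 0, sigma N = l &
    forall i, [/\ 0 <= sigma i, sigma i <= sigma i.+1, sigma i.+1 <= l &
      sigma i.+1 - sigma i <= th * h (sigma i)]].
Proof.
move=> l0 th0 HN.
pose fix sigma (i : nat) : R :=
  if i is j.+1 then Num.min l (sigma j + th * h (sigma j)) else 0.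
have sl i : sigma i <= l by case: i => [|i] //=; rewrite ge_min lexx.
have step i : 0 < th * h (sigma i) by rewrite mulr_gt0.
have mono i : sigma i <= sigma i.+1 by rewrite /= le_min sl lerDl ltW.
have pos i : 0 <= sigma i by elim: i => // i IH; rewrite (le_trans IH).
have th1 : 0 < 1 + th by lra.
have full i : sigma i.+1 < l -> sigma i.+1 = sigma i + th * h (sigma i).
  rewrite /= gt_min ltxx /= => lt.
  by apply/min_r/ltW.
have bound i : sigma i < l -> ((i%:R * (th / (1 + th)))%:E <=
    \int[lebesgue_measure]_(s in `[0%R, sigma i]) (h s)^-1%:E)%E.
  elim: i => [|i IH] il.
    by rewrite mul0r; apply: integral_ge0 => s _; rewrite lee_fin inv_ge0.
  rewrite (integral_itvD inv_continuous inv_ge0 (pos i) (mono i)).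
  rewrite -natr1 mulrDl mul1r EFinD leeD//; first exact: IH (le_lt_trans (mono i) il).
  have -> : th / (1 + th) = ((1 + th) * h (sigma i))^-1 * (sigma i.+1 - sigma i).
    by rewrite (full i il) [sigma i + _]addrC addrK; field; rewrite !gt_eqF.
  apply: (integral_itv_ge inv_continuous (mono i)).
    by rewrite invr_ge0 mulr_ge0// ltW.
  move=> s /andP[ts si]; rewrite lef_pV2 ?posrE ?mulr_gt0//.
  have := h_lip s (sigma i); rewrite (ger0_norm (_ : 0 <= s - _)) ?subr_ge0//.
  move/(le_trans (ler_norm _)); rewrite (full i il) in si; lra.
exists sigma; split => //; last first.
  move=> i; split; [exact: pos|exact: mono|exact: sl|].
  by rewrite lerBlDl /= ge_min lexx orbT.
apply/eqP; rewrite eq_le sl/= leNgt; apply/negP => Nl.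
move: HN; rewrite ltNge => /negP; apply; apply: (le_trans (bound N Nl)).
rewrite (integral_itvD inv_continuous inv_ge0 (pos N) (sl N)).
by rewrite leeDl//; apply: integral_ge0 => s _; rewrite lee_fin inv_ge0.
Qed.

End inverse_integral.

(** * Quasihyperbolic length of curves and chains *)

Lemma clamp_lip (R : realType) (l s t : R) : 0 <= l -> s <= t ->
  0 <= Num.max 0 (Num.min t l) - Num.max 0 (Num.min s l) <= t - s.
Proof.
move=> l0 st; have [sl|ls] := leP s l; have [tl|lt] := leP t l.
- by have [s0|s0] := leP 0 s; have [t0|t0] := leP 0 t; lra.
- by have [s0|s0] := leP 0 s; have [t0|t0] := leP 0 l; lra.
- lra.
- by have [t0|t0] := leP 0 l; lra.
Qed.

Section unit_speed.
Context (R : realType) (X : normedModType R).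
Implicit Types (g gamma : R -> X) (a b s t : R).

Lemma variation_sum_lip gamma (L a b : R) r :
  (forall s t, `|gamma s - gamma t| <= L * `|s - t|) ->
  path <%R a r -> variation_sum a b gamma r <= L * (last a r - a).
Proof.
move=> lip; elim: r a => [|t r IH] a; first by rewrite variation_sum_nil subrr mulr0.
move=> /= /andP[at_ tr]; rewrite variation_sum_cons.
have := lip t a; rewrite gtr0_norm ?subr_gt0// => H.
have -> : last t r - a = (t - a) + (last t r - t) by lra.
by rewrite mulrDr lerD// IH.
Qed.

Lemma path_length_lip gamma (L a b : R) :
  (forall s t, `|gamma s - gamma t| <= L * `|s - t|) ->
  (path_length a b gamma <= (L * (b - a))%:E)%E.
Proof.
move=> lip; apply: path_length_le => r [pr /eqP lr].
by rewrite lee_fin -lr; exact: variation_sum_lip.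
Qed.

Lemma eq_path_length gamma g a b : (forall s, a <= s <= b -> gamma s = g s) ->
  path_length a b gamma = path_length a b g.
Proof.
suff key (f1 f2 : R -> X) : (forall s, a <= s <= b -> f1 s = f2 s) ->
    (path_length a b f1 <= path_length a b f2)%E.
  by move=> H; apply/eqP; rewrite eq_le !key// => s /H.
move=> H; apply: path_length_le => r abr.
suff -> : variation_sum a b f1 r = variation_sum a b f2 r.
  exact: variation_sum_le_path_length.
elim: r a abr H => [|t r IH] a abr H; first by rewrite !variation_sum_nil.
have tbr := itv_partition_cons abr.
have at_ : a < t by case: abr => /= /andP[].
have tb := itv_partition_le tbr.
rewrite !variation_sum_cons !H ?lexx ?(ltW at_)//; last exact: (le_trans (ltW at_)).
rewrite IH// => s /andP[ts sb]; apply: H.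
by rewrite sb (le_trans (ltW at_)).
Qed.

Lemma path_length_scale g (l a b : R) : 0 < l ->
  (path_length (l * a) (l * b) g <= path_length a b (fun s => g (l * s)%R))%E.
Proof.
move=> l0; apply: path_length_le => r [pr lr].
pose f s := l^-1 * s.
have fK s : l * f s = s by rewrite /f mulrA divff ?mul1r// gt_eqF.
have mapr : variation_sum a b (fun s => g (l * s)) (map f r) =
    variation_sum (l * a) (l * b) g r.
  elim: r a {pr lr} => [|t r IH] a; first by rewrite !variation_sum_nil.
  rewrite /= !variation_sum_cons fK; congr (_ + _).
  by have := IH (f t); rewrite fK.
rewrite -mapr; apply: variation_sum_le_path_length.
have fa c : f (l * c) = c by rewrite /f mulrA mulVf ?mul1r// gt_eqF.
split; last by rewrite -[a]fa last_map (eqP lr) fa.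
rewrite -[a]fa path_map; apply: sub_path pr => s t st.
by rewrite /f/= ltr_pM2l// invr_gt0.
Qed.

End unit_speed.

Section quasihyperbolic.
Context (R : realType) (X : normedModType R) (Omega : set X).
Hypotheses (Oopen : open Omega) (Obound : boundary Omega !=set0).
Implicit Types (x y z : X).
Let d z := set_dist z (boundary Omega).
Let rho z := (d z)^-1.
Let k := qh_metric Omega.

Lemma boundary_dist_ge0 z : 0 <= d z.
Proof. by apply: set_dist_ge. Qed.

Lemma boundary_dist_lip z w : `|d z - d w| <= `|z - w|.
Proof.
have := set_dist_lip z w Obound; have := set_dist_lip w z Obound.
by rewrite -/(d z) -/(d w) [`|w - z|]distrC ler_norml => *; apply/andP; split; lra.
Qed.

Lemma line_integral_ge0 gamma : (0 <= line_integral gamma rho)%E.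
Proof.
by apply: integral_ge0 => s _; rewrite lee_fin invr_ge0 boundary_dist_ge0.
Qed.

(** Arc-length parametrisations of curves from [x] to [y] along which the
    density integrates to at most [S]. They are 1-Lipschitz maps of the whole
    line to [Omega], along which [d] is therefore positive and continuous, and
    they rest at [y] beyond the length [l], where further pieces are added. *)
Definition unit_speed_path x y (S : R) := exists (l : R) (g : R -> X),
  [/\ [/\ 0 <= l, forall s t, `|g s - g t| <= `|s - t| & forall s, Omega (g s)],
      g 0 = x, forall s, l <= s -> g s = y,
      forall s, 0 <= s <= l -> path_length 0 s g = s%:E &
      (\int[lebesgue_measure]_(s in `[0%R, l]) (rho (g s))%:E <= S%:E)%E].

Lemma unit_speed_path_refl x : Omega x -> unit_speed_path x x 0.
Proof.
move=> Ox; exists 0, (fun _ => x); split => //.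
- by split => // s t; rewrite subrr normr0.
- by move=> s; rewrite -eq_le => /eqP <-; apply/eqP; rewrite eq_le path_length_ge0//
    andbT path_length_le// => r /itv_partitionxx ->; rewrite variation_sum_nil.
- by rewrite set_itv1 integral_set1.
Qed.

(** A segment from [y] to [z] is appended to the path; [kap s] is the part of it
    that has been covered at arc length [s]. The length of the longer path is
    bounded above by the Lipschitz property and below by the distance between
    the ends of the segment. *)
Lemma unit_speed_path_step x y z (S c : R) : unit_speed_path x y S ->
  (forall t, 0 <= t <= 1 -> Omega (y + t *: (z - y)) /\
     `|z - y| <= c * d (y + t *: (z - y))) ->
  unit_speed_path x z (S + c).
Proof.
move=> [l [g [[l0 glip gO] g0 gl glen gint]]] H.
have Hy := H 0; have Hz := H 1; rewrite scale1r [y + _]addrC subrK in Hz.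
rewrite scale0r addr0 in Hy.
have {Hy}[Oy cy] : Omega y /\ `|z - y| <= c * d y by apply: Hy; rewrite lexx ler01.
have dy : 0 < d y by exact: boundary_dist_gt0.
have c0 : 0 <= c by rewrite -(pmulr_lge0 _ dy) (le_trans _ cy).
have [->|zy] := eqVneq z y.
  exists l, g; split => //; rewrite (le_trans gint)// lee_fin lerDl//.
set r := `|z - y|.
have r0 : 0 < r by rewrite normr_gt0 subr_eq0.
pose kap s := Num.max 0 (Num.min (s - l) r).
pose u := r^-1 *: (z - y).
have nu : `|u| = 1 by rewrite normrZ gtr0_norm ?invr_gt0// mulVf// gt_eqF.
pose g' s := g s + kap s *: u.
have kl s : s <= l -> kap s = 0.
  move=> sl; apply: max_l; rewrite (le_trans (_ : _ <= s - l)) ?subr_le0//.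
  by rewrite ge_min lexx.
have kr s : l <= s <= l + r -> kap s = s - l.
  move=> /andP[ls slr]; rewrite /kap min_l ?max_r ?subr_ge0//; lra.
have kr' s : l + r <= s -> kap s = r.
  move=> slr; rewrite /kap min_r ?max_r ?(ltW r0)//; lra.
have k01 s : 0 <= kap s <= r.
  by rewrite /kap le_max lexx/= ge_max ltW//= ge_min lexx orbT.
have klip s t : s <= t -> `|kap t - kap s| <= t - s.
  move=> st; have st' : s - l <= t - l by rewrite lerD2r.
  have /andP[k0 k1] := clamp_lip (ltW r0) st'.
  rewrite ger0_norm; last exact: k0.
  by apply: le_trans k1 _; rewrite opprB addrA subrK.
have g'l s : s <= l -> g' s = g s by move=> sl; rewrite /g' kl// scale0r addr0.
have g'r s : l <= s -> g' s = y + (kap s / r) *: (z - y).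
  by move=> ls; rewrite /g' gl// /u scalerA.
have kr01 s : 0 <= kap s / r <= 1.
  have /andP[k0 k1] := k01 s.
  by rewrite ler_pdivrMr// mul1r k1 andbT divr_ge0// ltW.
have g'lip s t : `|g' s - g' t| <= `|s - t|.
  wlog st : s t / s <= t.
    move=> W; have [/W//|/ltW/W] := leP s t.
    by rewrite distrC [`|t - s|]distrC.
  rewrite distrC [`|s - t|]distrC [`|t - s|]ger0_norm ?subr_ge0//.
  have [tl|lt] := leP t l.
    by rewrite !g'l ?(le_trans st)// (le_trans (glip _ _))// ger0_norm ?subr_ge0.
  have [ls|sl] := leP l s.
    rewrite /g' !gl// ?(ltW lt)// opprD addrACA subrr add0r -scalerBl normrZ nu mulr1.
    exact: klip.
  rewrite (g'l s (ltW sl)) /g' (gl t (ltW lt)) addrAC.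
  rewrite (le_trans (ler_normD _ _))//.
  have -> : t - s = (l - s) + (t - l) by lra.
  apply: lerD.
    by rewrite -(gl l)// (le_trans (glip _ _))// ger0_norm// subr_ge0 ltW.
  rewrite normrZ nu mulr1; have := klip l t (ltW lt).
  by rewrite (kl l)// subr0.
have g'O s : Omega (g' s).
  have [sl|/ltW ls] := leP s l; first by rewrite g'l.
  by rewrite g'r//; have [] := H _ (kr01 s).
have lr : l <= l + r by rewrite lerDl ltW.
have g'len1 s : 0 <= s <= l -> path_length 0 s g' = s%:E.
  move=> /andP[s0 sl]; rewrite -glen ?s0//; apply: eq_path_length => t /andP[_ ts].
  by rewrite g'l// (le_trans ts).
exists (l + r), g'; split => //.
- by split => //; rewrite addr_ge0// ltW.
- by rewrite g'l.
- move=> s ls; rewrite g'r ?(le_trans lr)// kr'// divff ?gt_eqF// scale1r.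
  by rewrite addrC subrK.
- move=> s /andP[s0 slr]; have [sl|/ltW ls] := leP s l.
    by rewrite g'len1// s0.
  apply/eqP; rewrite eq_le; apply/andP; split.
    have := @path_length_lip _ _ g' 1 0 s; rewrite mul1r subr0; apply => a b.
    by rewrite mul1r.
  rewrite (path_lengthD g' l0 ls) g'len1 ?l0 ?lexx//.
  have -> : s = l + (s - l) by lra.
  rewrite EFinD leeD2l//; apply: le_trans (norm_le_path_length g' _); last by lra.
  rewrite [l + _]addrC subrK (g'l l)// (gl l)// /g' gl// [y + _]addrC addrK.
  by rewrite lee_fin normrZ nu mulr1 kr ?ls// ger0_norm// subr_ge0.
- have rg_gt0 s : 0 < d (g' s) by exact: boundary_dist_gt0.
  have rg_lip s t : `|d (g' s) - d (g' t)| <= `|s - t|.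
    exact: le_trans (boundary_dist_lip _ _) (g'lip _ _).
  have ic := inv_continuous rg_gt0 rg_lip.
  rewrite (integral_itvD ic (inv_ge0 rg_gt0) l0 lr) EFinD; apply: leeD.
    rewrite (le_trans _ gint)// le_eqVlt; apply/orP; left; apply/eqP.
    apply: eq_integral => s; rewrite inE /= in_itv/= => /andP[_ sl].
    by rewrite g'l.
  have -> : c = c / r * (l + r - l).
    by rewrite [l + r]addrC addrK divfK// gt_eqF.
  apply: (integral_itv_le ic (inv_ge0 rg_gt0) lr) => s /andP[ls _].
  rewrite invf_ple ?posrE ?divr_gt0//; last first.
    rewrite lt_neqAle c0 andbT eq_sym; apply: contraTneq cy => ->.
    by rewrite mul0r -ltNge.
  rewrite invf_div ler_pdivrMr; last first.
    rewrite lt_neqAle c0 andbT eq_sym; apply: contraTneq cy => ->.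
    by rewrite mul0r -ltNge.
  by rewrite mulrC g'r//; have [] := H _ (kr01 s).
Qed.


(** The path is brought to the interval [[0, 1]] by scaling its parameter, which
    makes its arc length proportional to the parameter. *)
Lemma unit_speed_path_curve x y S : unit_speed_path x y S ->
  exists gamma, [/\ path_in Omega x y gamma, rectifiable gamma &
    (line_integral gamma rho <= S%:E)%E].
Proof.
move=> [l [g [[l0 glip gO] g0 gl glen gint]]].
pose gamma t := g (l * t).
have lip s t : `|gamma s - gamma t| <= l * `|s - t|.
  by rewrite (le_trans (glip _ _))// -mulrBr normrM ger0_norm.
have len t : 0 <= t <= 1 -> path_length 0 t gamma = (l * t)%:E.
  move=> /andP[t0 t1]; apply/eqP; rewrite eq_le; apply/andP; split.
    by have := path_length_lip 0 t lip; rewrite subr0.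
  have [->|lN] := eqVneq l 0; first by rewrite mul0r path_length_ge0.
  have l1 : 0 < l by rewrite lt_neqAle eq_sym lN.
  have := path_length_scale g 0 t l1; rewrite mulr0 glen//.
  by rewrite mulr_ge0//= -[leRHS]mulr1 ler_wpM2l.
have len1 : path_length 0 1 gamma = l%:E by rewrite len ?lexx ?ler01// mulr1.
have cont : {within `[0, 1], continuous gamma}.
  apply: continuous_subspaceT => t; apply/cvgrPdist_lt => e e0; apply/nbhs_normP.
  exists (e / (l + 1)) => /=; first by rewrite divr_gt0// ltr_wpDl.
  move=> s /=; rewrite ltr_pdivlMr ?ltr_wpDl// => st.
  apply: le_lt_trans (lip _ _) (le_lt_trans _ st).
  by rewrite mulrC ler_wpM2l// lerDl.
have rect : rectifiable gamma by rewrite /rectifiable len1 ltey.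
exists gamma; split => //.
  split => //.
  - by rewrite /gamma mulr0.
  - by rewrite /gamma mulr1 gl.
  - by move=> _ [t _ <-]; exact: gO.
rewrite /line_integral len1/=; apply: le_trans gint.
rewrite le_eqVlt; apply/orP; left; apply/eqP.
apply: eq_integral => s; rewrite inE/= in_itv/= => sl.
have := arc_paramP cont rect; rewrite len1/= => /(_ s sl)[t [t01 ts ->]].
by move: ts; rewrite len// => -[<-].
Qed.

Lemma qh_le x y S : unit_speed_path x y S -> k x y <= S.
Proof.
move=> /unit_speed_path_curve[gamma [ing rg gS]].
rewrite -lee_fin; apply: le_trans gS; rewrite /k /qh_metric.
set Q := ereal_inf _.
have Q0 : (0 <= Q)%E.
  by apply: le_ereal_inf_tmp => _ [g _ <-]; exact: line_integral_ge0.
have QS : (Q <= line_integral gamma rho)%E by apply: ereal_inf_lbound; exists gamma.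
have [->|] := eqVneq Q +oo%E; first by rewrite line_integral_ge0.
by move=> QN; rewrite fineK// ge0_fin_numE// ltey.
Qed.

Lemma qh_ge0 x y : 0 <= k x y.
Proof.
by apply: fine_ge0; apply: le_ereal_inf_tmp => _ [g _ <-]; exact: line_integral_ge0.
Qed.

(** Along a curve in arc length parametrisation [a], the distance to the boundary
    is 1-Lipschitz and [greedy_partition] applies. The curve is chosen with
    integral less than some [T' < T], so that [T' < N * (th / (1 + th))] follows
    from [T <= N * th] for small [th]. *)
Lemma qh_chain x y (T : R) : (exists S, unit_speed_path x y S) -> k x y < T ->
  exists2 th0 : R, 0 < th0 & forall th (N : nat), 0 < th < th0 -> T <= N%:R * th ->
    exists z : nat -> X, [/\ z 0%N = x, z N = y, forall i, Omega (z i) &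
      forall i, `|z i.+1 - z i| <= th * d (z i)].
Proof.
move=> [S /unit_speed_path_curve[gamma0 [in0 r0 S0]]] kT.
set Q := [set line_integral gamma rho | gamma in
  [set gamma | path_in Omega x y gamma /\ rectifiable gamma]].
have Q0 : (0 <= ereal_inf Q)%E.
  by apply: le_ereal_inf_tmp => _ [g _ <-]; exact: line_integral_ge0.
have Qfin : ereal_inf Q \is a fin_num.
  rewrite ge0_fin_numE//; apply: le_lt_trans (ltry S); apply: le_trans S0.
  by apply: ereal_inf_lbound; exists gamma0.
pose T' := (k x y + T) / 2.
have k0 := qh_ge0 x y.
have [T'0 kT' T'T] : [/\ 0 <= T', k x y < T' & T' < T] by rewrite /T'; split; lra.
have : (ereal_inf Q < T'%:E)%E by rewrite -(fineK Qfin) lte_fin.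
move=> /ereal_inf_lt[_ [gamma [[gcont gamma_0 gamma_1 gO] grect] <-]] gT.
have T'1 : 0 < T' + 1 by rewrite ltr_wpDl.
exists ((T - T') / (T' + 1)); first by rewrite divr_gt0 ?subr_gt0.
move=> th N /andP[th_gt0]; rewrite ltr_pdivlMr// => thT TN.
set l := fine (path_length 0 1 gamma).
have l0 : 0 <= l by rewrite fine_ge0// path_length_ge0.
have T1 : T' < N%:R * (th / (1 + th)).
  have th1 : 0 < 1 + th by lra.
  by rewrite mulrA ltr_pdivlMr//; lra.
(* Clamping the parameter extends the curve to the whole line. *)
pose c s := Num.max 0 (Num.min s l).
have c01 s : 0 <= c s <= l by rewrite /c le_max lexx/= ge_max l0 ge_min lexx orbT.
have cE s : 0 <= s <= l -> c s = s.
  by move=> /andP[s0 sl]; rewrite /c min_l// max_r.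
have cmono s t : s <= t -> 0 <= c t - c s <= t - s by exact: clamp_lip.
pose a s := arc_param gamma (c s).
have aO s : Omega (a s).
  rewrite /a; have [t [t01 _ ->]] := arc_paramP gcont grect (c01 s).
  by apply: gO; exists t => //=; rewrite in_itv.
have alip s t : `|a s - a t| <= `|s - t|.
  wlog st : s t / t <= s.
    move=> W; have [/W//|/ltW/W] := leP t s.
    by rewrite distrC [`|t - s|]distrC.
  have /andP[cs0 cst] := cmono _ _ st; rewrite subr_ge0 in cs0.
  rewrite [`|s - t|]ger0_norm ?subr_ge0//; apply: le_trans cst.
  apply: (arc_param_lip gcont grect) => //; first by case/andP: (c01 t).
  by case/andP: (c01 s).
have hpos s : 0 < d (a s) by exact: boundary_dist_gt0.
have hlip s t : `|d (a s) - d (a t)| <= `|s - t|.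
  exact: le_trans (boundary_dist_lip _ _) (alip _ _).
have [|sigma [sigma0 sigmaN Hs]] := @greedy_partition R (d \o a) hpos hlip l th N l0 th_gt0.
  apply: lt_trans (_ : (_ < T'%:E)%E) _; last by rewrite lte_fin.
  apply: le_lt_trans gT; rewrite le_eqVlt; apply/orP; left; apply/eqP.
  apply: eq_integral => s; rewrite inE/= in_itv/= => sl.
  by rewrite /a cE.
exists (a \o sigma); split => /=.
- by rewrite sigma0 /a cE ?lexx// (arc_param0 gcont grect).
- by rewrite sigmaN /a cE ?lexx ?l0// (arc_param1 gcont grect).
- by move=> i; exact: aO.
- move=> i; have [_ si _ sd] := Hs i.
  by rewrite (le_trans (alip _ _))// ger0_norm ?subr_ge0.
Qed.


Hypothesis Oconvex : convex_set Omega.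

(** By concavity, the bounds at the end points hold on the whole segment. *)
Lemma unit_speed_path_edge x y z (S c : R) : unit_speed_path x y S ->
  Omega y -> Omega z -> `|z - y| <= c * d y -> `|z - y| <= c * d z ->
  unit_speed_path x z (S + c).
Proof.
move=> xyS Oy Oz cy cz; apply: (unit_speed_path_step xyS) => t t01.
split; first exact: domain_convex.
have dy : 0 < d y by exact: boundary_dist_gt0.
have c0 : 0 <= c by rewrite -(pmulr_lge0 _ dy) (le_trans _ cy).
apply: (@le_trans _ _ (c * (d y + t * (d z - d y)))); last first.
  by rewrite ler_wpM2l//; exact: boundary_dist_concave.
have -> : c * (d y + t * (d z - d y)) = (1 - t) * (c * d y) + t * (c * d z) by ring.
have -> : `|z - y| = (1 - t) * `|z - y| + t * `|z - y| by ring.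
have /andP[t0 t1] := t01.
by apply: lerD; apply: ler_wpM2l => //; rewrite subr_ge0.
Qed.

(** The distance to the boundary decreases by the factor [1 - th] at most. *)
Lemma unit_speed_path_relative_step x y z (S th : R) : unit_speed_path x y S ->
  Omega y -> Omega z -> 0 <= th < 1 -> `|z - y| <= th * d y ->
  unit_speed_path x z (S + th / (1 - th)).
Proof.
move=> xyS Oy Oz /andP[th0 th1] zy.
have dy : 0 < d y by exact: boundary_dist_gt0.
have t1 : 0 < 1 - th by rewrite subr_gt0.
have dz : (1 - th) * d y <= d z.
  by have := le_trans (ler_norm _) (boundary_dist_lip y z); rewrite distrC; lra.
apply: (unit_speed_path_edge xyS) => //; apply: (le_trans zy).
  rewrite ler_wpM2r ?(ltW dy)// ler_pdivlMr//.
  by rewrite mulrBr mulr1 lerBlDr lerDl mulr_ge0.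
by rewrite mulrAC ler_pdivlMr// -mulrA ler_wpM2l// mulrC.
Qed.

Lemma unit_speed_path_chain (z : nat -> X) (h : nat -> R) x (S : R) (N : nat) :
  unit_speed_path x (z 0%N) S -> (forall i, Omega (z i)) ->
  (forall i, (i < N)%N -> 0 <= h i < 1) ->
  (forall i, (i < N)%N -> `|z i.+1 - z i| <= h i * d (z i)) ->
  unit_speed_path x (z N) (S + \sum_(i < N) h i / (1 - h i)).
Proof.
move=> xz Oz; elim: N => [|N IH] h01 zh; first by rewrite big_ord0 addr0.
rewrite big_ord_recr/= addrA; apply: unit_speed_path_relative_step => //.
- by apply: IH => i iN; [apply: h01|apply: zh]; rewrite ltnW.
- exact: h01.
- exact: zh.
Qed.

Lemma unit_speed_path_exists x y : Omega x -> Omega y ->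
  exists S, unit_speed_path x y S.
Proof.
move=> Ox Oy.
have dx : 0 < d x by exact: boundary_dist_gt0.
have dy : 0 < d y by exact: boundary_dist_gt0.
exists (0 + (`|y - x| / d x + `|y - x| / d y)).
apply: (unit_speed_path_edge (unit_speed_path_refl Ox)) => //.
  by rewrite mulrDl divfK ?gt_eqF// lerDl mulr_ge0// ?divr_ge0// ltW.
by rewrite mulrDl [_ / d y * _]divfK ?gt_eqF// lerDr mulr_ge0// ?divr_ge0// ltW.
Qed.

Lemma le_of_le_add (a b C : R) :
  (forall e, 0 < e < 1 -> a <= b + C * e) -> a <= b.
Proof.
move=> H; apply/ler_addgt0Pr => e e0.
pose f := Num.min (1 / 2) (e / (`|C| + 1)).
have C1 : 0 < `|C| + 1 by rewrite ltr_wpDl.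
have f0 : 0 < f by rewrite lt_min divr_gt0//= divr_gt0.
have f1 : f <= 1 / 2 by rewrite ge_min lexx.
have fe : f * (`|C| + 1) <= e by rewrite -ler_pdivlMr// ge_min lexx orbT.
have := H f; have := ler_norm C; nra.
Qed.

Lemma fine_chain x y (T : R) : Omega x -> Omega y -> 0 < T -> k x y < T ->
  forall e, 0 < e -> exists th (N : nat) (z : nat -> X),
  [/\ 0 < th < e, N%:R * th = T & [/\ z 0%N = x, z N = y, forall i, Omega (z i) &
      forall i, `|z i.+1 - z i| <= th * d (z i)]].
Proof.
move=> Ox Oy T0 kT e e0.
have [th0 th00 H] := qh_chain (unit_speed_path_exists Ox Oy) kT.
have m0 : 0 < Num.min th0 e by rewrite lt_min th00.
pose N := (Num.truncn (T / Num.min th0 e)).+1.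
have N0 : 0 < N%:R :> R by rewrite ltr0n.
have NT : T / N%:R < Num.min th0 e.
  by rewrite ltr_pdivrMr// mulrC -ltr_pdivrMr// truncnS_gt.
exists (T / N%:R), N; move: NT; rewrite lt_min => /andP[N1 N2].
have [||z Hz] := H (T / N%:R) N.
- by rewrite N1 divr_gt0.
- by rewrite mulrC divfK ?gt_eqF.
exists z; split => //; first by rewrite N2 divr_gt0.
by rewrite mulrC divfK ?gt_eqF.
Qed.

Lemma inv1B_le (th : R) : 0 <= th <= 1 / 2 -> (1 - th)^-1 <= 1 + 2 * th.
Proof.
move=> th01; rewrite -[leLHS]mul1r ler_pdivrMr; first nra.
lra.
Qed.

(** Moving the end points costs no more than the added segments. *)
Lemma qh_lipschitz x y x' y' (a b : R) :
  Omega x -> Omega y -> Omega x' -> Omega y' ->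
  `|x' - x| <= a * d x -> `|x' - x| <= a * d x' ->
  `|y' - y| <= b * d y -> `|y' - y| <= b * d y' ->
  k x' y' <= k x y + (a + b).
Proof.
move=> Ox Oy Ox' Oy' ax ax' by_ by'.
apply: (@le_of_le_add _ _ (1 + 2 * (k x y + 1))) => e e01.
have k0 := qh_ge0 x y.
pose T := k x y + e.
have [T0 kT] : 0 < T /\ k x y < T by rewrite /T; split; lra.
have e2 : 0 < e / 2 by lra.
have [th [N [z [/andP[th0 the] NT [z0 zN zO zd]]]]] := fine_chain Ox Oy T0 kT e2.
have P1 : unit_speed_path x' x (0 + a).
  by apply: (unit_speed_path_edge (unit_speed_path_refl Ox')); rewrite // distrC.
rewrite -z0 in P1.
have P2 : unit_speed_path x' (z N) (0 + a + \sum_(i < N) th / (1 - th)).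
  apply: (@unit_speed_path_chain z (fun=> th)) => // i _; lra.
rewrite zN sumr_const card_ord in P2.
have /qh_le := unit_speed_path_edge P2 Oy Oy' by_ by'.
move/le_trans; apply.
rewrite -[_ / _ *+ N]mulr_natl mulrA NT add0r.
have : T / (1 - th) <= T * (1 + 2 * th) by rewrite ler_pM2l// inv1B_le//; lra.
rewrite /T; nra.
Qed.

(** * Averaging two curves *)

Lemma segment_diff (a b c e : X) (t : R) :
  (b + t *: (e - b)) - (a + t *: (c - a)) = (1 - t) *: (b - a) + t *: (e - c).
Proof.
have -> : (1 - t) *: (b - a) + t *: (e - c) = (b - a) + t *: ((e - c) - (b - a)).
  by rewrite scalerBl scale1r [in RHS]scalerBr addrA addrAC.
rewrite opprD addrACA -scalerBr.
congr (_ + _ *: _); rewrite -!addrA; congr (_ + _).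
by rewrite !opprB addrCA [RHS]addrCA [- b - c]addrC.
Qed.

Lemma bernoulli_le (th : R) (n : nat) : 0 <= th <= 1 -> 1 - n%:R * th <= (1 - th) ^+ n.
Proof.
move=> th01; elim: n => [|n IH]; first by rewrite mul0r subr0 expr0.
rewrite exprS -natr1 mulrDl mul1r.
have : 0 <= n%:R * th by rewrite mulr_ge0//; case/andP: th01.
nra.
Qed.

Lemma average_error (K Q kap th e : R) : 0 <= K -> 0 <= Q <= kap -> 0 < e < 1 ->
  0 < th < e / 2 ->
  (K + e + th + Q) * (1 + 2 * th) <= K + Q + (2 + 2 * (K + kap + 2)) * e.
Proof.
move=> K0 /andP[Q0 Qk] e01 th01.
have S1 : (K + e + th + Q) * (1 + 2 * th) <= (K + Q + 3 / 2 * e) * (1 + e).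
  by apply: ler_pM; lra.
have S2 : e * e <= e by rewrite -[leRHS]mulr1 ler_pM2l; lra.
have S3 : Q * e <= kap * e by rewrite ler_wpM2r//; lra.
have S4 : 0 <= K * e by rewrite mulr_ge0//; lra.
have S5 : 0 <= kap * e by rewrite mulr_ge0//; lra.
lra.
Qed.

(** The average [v] of two chains [z], [w] with the same relative step [th]. The
    chain [w] arrives at [y1] after [N] steps and waits there during the last
    [M] steps of [z], where [M * th = kap]. By concavity of [d], the steps of
    [v] have relative size at most [th] before ([early]) and [th * r] after
    ([late]) the arrival of [w]. The latter uses that the distance to the
    boundary at the last [M] points of [z] is at most [d y0 / (1 - kap)]
    ([back], [dzq]). The claim follows when [e] and [th] tend to [0]. *)
Lemma qh_average x0 y0 x1 y1 (t kap : R) :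
  Omega x0 -> Omega y0 -> Omega x1 -> Omega y1 ->
  0 <= t <= 1 -> 0 < kap < 1 -> k x0 y0 <= k x1 y1 + kap ->
  k (x0 + t *: (x1 - x0)) (y0 + t *: (y1 - y0)) <=
  k x1 y1 + kap * ((1 - t) / (1 - t + t * ((1 - kap) * d y1 / d y0))).
Proof.
move=> Ox0 Oy0 Ox1 Oy1 t01 /andP[kap0 kap1] k01.
have /andP[t0 t1] := t01.
have s0 : 0 <= 1 - t by rewrite subr_ge0.
have dy0 : 0 < d y0 by exact: boundary_dist_gt0.
have dy1 : 0 < d y1 by exact: boundary_dist_gt0.
set q := (1 - kap) * d y1 / d y0.
have q0 : 0 < q by rewrite divr_gt0// mulr_gt0// subr_gt0.
have D0 : 0 < 1 - t + t * q by nra.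
set r := (1 - t) / (1 - t + t * q).
have r0 : 0 <= r by rewrite divr_ge0 ?(ltW D0)// subr_ge0.
have r1 : r <= 1 by rewrite ler_pdivrMr// mul1r lerDl mulr_ge0// ltW.
have k1 := qh_ge0 x1 y1.
apply: (@le_of_le_add _ _ (2 + 2 * (k x1 y1 + kap + 2))) => e e01.
pose T1 := k x1 y1 + e.
have kT1 : k x1 y1 < T1 by rewrite /T1; lra.
have kT0 : k x0 y0 < T1 + kap by rewrite /T1; lra.
have [tha tha0 Ha] := qh_chain (unit_speed_path_exists Ox0 Oy0) kT0.
have [thb thb0 Hb] := qh_chain (unit_speed_path_exists Ox1 Oy1) kT1.
have m0 : 0 < Num.min (Num.min tha thb) (e / 2) by rewrite !lt_min tha0 thb0; lra.
pose M := (Num.truncn (kap / Num.min (Num.min tha thb) (e / 2))).+1.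
pose th := kap / M%:R.
have M0 : 0 < M%:R :> R by rewrite ltr0n.
have th0 : 0 < th by rewrite divr_gt0.
have MT : M%:R * th = kap by rewrite mulrC divfK// gt_eqF.
have : th < Num.min (Num.min tha thb) (e / 2).
  by rewrite ltr_pdivrMr// mulrC -ltr_pdivrMr// truncnS_gt.
rewrite !lt_min => /andP[/andP[tha1 thb1] the].
clearbody th.
pose N := (Num.truncn (T1 / th)).+1.
have NT : T1 <= N%:R * th by rewrite -ler_pdivrMr// ltW// truncnS_gt.
have NT' : N%:R * th <= T1 + th.
  rewrite -natr1 mulrDl mul1r lerD2r -ler_pdivlMr//.
  by rewrite truncn_le// divr_ge0 ?(ltW th0)//; lra.
have [||z [z0 zN zO zd]] := Ha th (N + M)%N.
- by rewrite th0.
- by rewrite natrD mulrDl MT lerD2r.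
have [||w0 [w00 w0N w0O w0d]] := Hb th N.
- by rewrite th0.
- by [].
pose w i := w0 (minn i N).
pose v i := z i + t *: (w i - z i).
have wO i : Omega (w i) by exact: w0O.
have vO i : Omega (v i) by exact: domain_convex.
have dv i : d (z i) + t * (d (w i) - d (z i)) <= d (v i).
  exact: boundary_dist_concave.
have vd i : v i.+1 - v i = (1 - t) *: (z i.+1 - z i) + t *: (w i.+1 - w i).
  exact: segment_diff.
have dz_pos i : 0 < d (z i) by exact: boundary_dist_gt0.
have early i : (i < N)%N -> `|v i.+1 - v i| <= th * d (v i).
  move=> iN; rewrite vd (le_trans (ler_normD _ _))// !normrZ.
  rewrite (ger0_norm t0) (ger0_norm s0).
  have A := zd i; have B : `|w i.+1 - w i| <= th * d (w i).
    by rewrite /w !(minn_idPl _)// ltnW.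
  have : (1 - t) * `|z i.+1 - z i| <= (1 - t) * (th * d (z i)).
    by rewrite ler_wpM2l.
  have : t * `|w i.+1 - w i| <= t * (th * d (w i)) by rewrite ler_wpM2l.
  have : th * (d (z i) + t * (d (w i) - d (z i))) <= th * d (v i).
    by rewrite ler_pM2l.
  lra.
have th1 : 0 <= th <= 1 by rewrite ltW//=; lra.
have sth : 0 <= 1 - th by rewrite subr_ge0; case/andP: th1.
have back i j : (1 - th) ^+ j * d (z i) <= d (z (i + j)%N).
  elim: j => [|j IH]; first by rewrite expr0 mul1r addn0.
  rewrite exprS -mulrA addnS.
  have A : (1 - th) * d (z (i + j)%N) <= d (z (i + j).+1).
    have := le_trans (ler_norm _) (boundary_dist_lip (z (i + j)%N) (z (i + j).+1)).
    by rewrite distrC; have := zd (i + j)%N; lra.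
  by apply: le_trans A; rewrite ler_wpM2l.
have dzq i : (N <= i < N + M)%N -> q * d (z i) <= d y1.
  move=> /andP[Ni iNM]; rewrite /q mulrAC ler_pdivrMr// mulrAC.
  rewrite [leRHS]mulrC ler_wpM2r ?(ltW dy1)//.
  have := back i (N + M - i)%N; rewrite subnKC ?(ltnW iNM)// zN.
  apply: le_trans; rewrite ler_wpM2r ?(ltW (dz_pos i))//.
  apply: le_trans (bernoulli_le _ th1); rewrite lerD2l lerN2 -MT.
  by rewrite ler_pM2r// ler_nat leq_subLR leq_add2r.
have late i : (N <= i < N + M)%N -> `|v i.+1 - v i| <= th * r * d (v i).
  move=> iNM; have /andP[Ni _] := iNM; rewrite vd.
  rewrite /w (minn_idPr _) ?(minn_idPr Ni) ?(leqW Ni)// subrr scaler0 addr0.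
  rewrite normrZ (ger0_norm s0).
  have wi : w i = y1 by rewrite /w (minn_idPr Ni).
  apply: (@le_trans _ _ ((1 - t) * (th * d (z i)))).
    by rewrite ler_wpM2l ?zd.
  rewrite mulrCA -[leRHS]mulrA ler_pM2l// /r mulrAC ler_pdivlMr// -mulrA.
  rewrite ler_wpM2l//.
  apply: le_trans (dv i); rewrite wi; have := dzq i iNM; nra.
clearbody r.
have start : unit_speed_path (v 0%N) (v 0%N) 0 by exact: unit_speed_path_refl.
pose h i := if (i < N)%N then th else th * r.
have thr : 0 <= th * r <= th by rewrite mulr_ge0 ?(ltW th0)//= ler_piMr// ltW.
have chain : unit_speed_path (v 0%N) (v (N + M)%N)
    (0 + \sum_(i < N + M) h i / (1 - h i)).
  apply: unit_speed_path_chain => // i iNM; rewrite /h; case: ifP => iN.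
  - lra.
  - lra.
  - exact: early.
  - by apply: late; rewrite leqNgt iN.
have := qh_le chain.
rewrite add0r big_split_ord /= /v /w min0n z0 w00 (minn_idPr _) ?leq_addr// zN w0N.
move/le_trans; apply.
under eq_bigr => i _ do rewrite /h ltn_ord.
under [X in _ + X]eq_bigr => i _ do rewrite /h ltnNge leq_addr/=.
rewrite !sumr_const !card_ord -[_ / _ *+ N]mulr_natl -[_ / _ *+ M]mulr_natl.
rewrite !mulrA MT.
have A : N%:R * th / (1 - th) <= N%:R * th * (1 + 2 * th).
  by rewrite ler_wpM2l ?mulr_ge0 ?(ltW th0)// inv1B_le//; lra.
have B : kap * r / (1 - th * r) <= kap * r * (1 + 2 * th).
  rewrite ler_wpM2l ?mulr_ge0 ?(ltW kap0)//.
  apply: le_trans (inv1B_le _) _; lra.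
apply: le_trans (lerD A B) _; rewrite -mulrDl.
have C0 : N%:R * th + kap * r <= k x1 y1 + e + th + kap * r by rewrite /T1 in NT'; lra.
have kr : kap * r <= kap by rewrite ler_piMr// ltW.
have kr0 : 0 <= kap * r by rewrite mulr_ge0// ltW.
apply: (@le_trans _ _ ((k x1 y1 + e + th + kap * r) * (1 + 2 * th))).
  by rewrite ler_wpM2r//; lra.
by apply: average_error => //; lra.
Qed.

Lemma weight_le (t q eta : R) : 0 <= t <= 1 -> 0 <= eta <= 1 / 2 ->
  1 - eta <= q -> (1 - t) / (1 - t + t * q) <= (1 - t) * (1 + 2 * t * eta).
Proof.
move=> /andP[t0 t1] eta01 qeta.
have te : 0 <= t * eta <= 1 / 2 by apply/andP; split; nra.
have tq : t * (1 - eta) <= t * q by rewrite ler_wpM2l.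
have D0 : 0 < 1 - t + t * q by lra.
rewrite ler_wpM2l ?subr_ge0// -[leLHS]mul1r ler_pdivrMr//.
have A : (1 + 2 * t * eta) * (1 - t * eta) <= (1 + 2 * t * eta) * (1 - t + t * q).
  by rewrite ler_wpM2l//; lra.
apply: le_trans A; nra.
Qed.

(** [qh_average] for [kap] the difference of the two distances, to which
    [s * u ^+ 2] is added because [kap] has to be positive: this covers equal
    distances. *)
Lemma qh_average_local x0 y0 x1 y1 (t m L u : R) :
  Omega x0 -> Omega y0 -> Omega x1 -> Omega y1 ->
  0 < m -> m <= d y0 -> 0 <= L -> 0 <= t <= 1 ->
  0 < u <= 1 -> `|y1 - y0| <= u -> (L + 1 + m^-1) * u <= 1 / 2 ->
  0 <= k x0 y0 - k x1 y1 <= L * u ->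
  forall s, 0 < s <= 1 ->
  k (x0 + t *: (x1 - x0)) (y0 + t *: (y1 - y0)) <=
  k x1 y1 + (1 - t) * (k x0 y0 - k x1 y1 + s * u ^+ 2)
  + 2 * (t * (1 - t)) * ((L + 1 + m^-1) * u * ((L + 1) * u)).
Proof.
move=> Ox0 Oy0 Ox1 Oy1 m0 my0 L0 t01 /andP[u0 u1] y10 small /andP[de0 deL] s /andP[s0 s1].
have /andP[t0 t1] := t01.
set de := k x0 y0 - k x1 y1 in de0 deL *.
pose kap := de + s * u ^+ 2.
have sr : 0 < s * u ^+ 2 <= u.
  have u2 : 0 < u ^+ 2 by rewrite exprn_gt0.
  rewrite mulr_gt0//=; apply: (@le_trans _ _ (u ^+ 2)).
    by rewrite ler_piMl// ltW.
  by rewrite expr2 ler_piMl// ltW.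
have mr : 0 <= m^-1 * u by rewrite mulr_ge0 ?invr_ge0// ltW.
have kap0 : 0 < kap by rewrite /kap; lra.
have kapL : kap <= (L + 1) * u by rewrite /kap; lra.
have kap1 : kap <= 1 / 2 by lra.
have := @qh_average x0 y0 x1 y1 t kap Ox0 Oy0 Ox1 Oy1 t01.
have -> : 0 < kap < 1 by lra.
have -> : k x0 y0 <= k x1 y1 + kap by rewrite /kap /de; lra.
move=> /(_ isT isT) /le_trans; apply.
have eta01 : 0 <= (L + 1 + m^-1) * u <= 1 / 2.
  have m'0 : 0 < m^-1 by rewrite invr_gt0.
  by rewrite small andbT mulr_ge0 ?(ltW u0)//; lra.
have dy0 : 0 < d y0 := lt_le_trans m0 my0.
have qeta : 1 - (L + 1 + m^-1) * u <= (1 - kap) * d y1 / d y0.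
  have A : (1 - m^-1 * u) * d y0 <= d y1.
    have := le_trans (ler_norm _) (boundary_dist_lip y0 y1).
    rewrite distrC => B.
    have : u <= m^-1 * u * d y0.
      by rewrite mulrAC -[leLHS]mul1r ler_wpM2r ?(ltW u0)// mulrC ler_pdivlMr// mul1r.
    lra.
  rewrite ler_pdivlMr//.
  have : (1 - kap) * ((1 - m^-1 * u) * d y0) <= (1 - kap) * d y1.
    by rewrite ler_wpM2l//; lra.
  apply: le_trans; rewrite mulrA ler_wpM2r ?(ltW dy0)//; nra.
have W := weight_le t01 eta01 qeta.
have : kap * ((1 - t) / (1 - t + t * ((1 - kap) * d y1 / d y0))) <=
       kap * ((1 - t) * (1 + 2 * t * ((L + 1 + m^-1) * u))).
  by rewrite ler_wpM2l// ltW.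
set E := (L + 1 + m^-1) * u in eta01 *; rewrite -/de -/kap.
have : t * (1 - t) * (E * kap) <= t * (1 - t) * (E * ((L + 1) * u)).
  rewrite ler_wpM2l ?ler_wpM2l//; first by rewrite mulr_ge0// subr_ge0.
  by case/andP: eta01.
lra.
Qed.

(** Points near [xb] and [yb] have distance at least [m] to the boundary, which
    gives the Lipschitz constant [L = 2 / m]. For semiconvexity,
    [qh_average_local] is applied with the longer of the two curves first,
    exchanging [t] and [1 - t] if necessary, and with [s = t]. *)
Lemma qh_local xb yb : Omega xb -> Omega yb -> exists r C : R,
  [/\ 0 < r, 0 <= C & forall x0 y0 x1 y1,
    `|x0 - xb| < r -> `|y0 - yb| < r -> `|x1 - xb| < r -> `|y1 - yb| < r ->
    let u := Num.max `|x1 - x0| `|y1 - y0| in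
    `|k x0 y0 - k x1 y1| <= C * u /\
    forall t, 0 <= t <= 1 ->
      k (x0 + t *: (x1 - x0)) (y0 + t *: (y1 - y0)) <=
      k x0 y0 + t * (k x1 y1 - k x0 y0) + C * t * u ^+ 2].
Proof.
move=> Oxb Oyb.
have dxb : 0 < d xb by exact: boundary_dist_gt0.
have dyb : 0 < d yb by exact: boundary_dist_gt0.
pose m := Num.min (d xb) (d yb) / 2.
have m0 : 0 < m by rewrite divr_gt0// lt_min dxb.
have mx : 2 * m <= d xb by rewrite mulrC divfK// ge_min lexx.
have my : 2 * m <= d yb by rewrite mulrC divfK// ge_min lexx orbT.
clearbody m.
pose L := 2 * m^-1; pose E := L + 1 + m^-1.
have mV : 0 < m^-1 by rewrite invr_gt0.
have L0 : 0 < L by rewrite mulr_gt0.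
have E1 : 1 <= E by rewrite /E; lra.
pose r := Num.min m (1 / (4 * E)).
have r0 : 0 < r by rewrite lt_min m0 divr_gt0//; lra.
have rm : r <= m by rewrite ge_min lexx.
have rE : r * (4 * E) <= 1.
  by rewrite -ler_pdivlMr ?ge_min ?lexx ?orbT//; lra.
have nearx x : `|x - xb| < r -> Omega x /\ m <= d x.
  move=> xr; split; first by apply: (ball_boundary_dist Oopen Oxb); rewrite -/(d _); lra.
  by have := le_trans (ler_norm _) (boundary_dist_lip xb x); rewrite distrC; lra.
have neary y : `|y - yb| < r -> Omega y /\ m <= d y.
  move=> yr; split; first by apply: (ball_boundary_dist Oopen Oyb); rewrite -/(d _); lra.
  by have := le_trans (ler_norm _) (boundary_dist_lip yb y); rewrite distrC; lra.
pose C := L + 1 + 2 * (E * (L + 1)).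
have EL : 0 <= E * (L + 1) by rewrite mulr_ge0//; lra.
have C0 : 0 <= C by rewrite /C; lra.
exists r, C; split => // x0 y0 x1 y1 x0r y0r x1r y1r u.
have [[Ox0 dx0] [Oy0 dy0]] := (nearx _ x0r, neary _ y0r).
have [[Ox1 dx1] [Oy1 dy1]] := (nearx _ x1r, neary _ y1r).
have ux : `|x1 - x0| <= u by rewrite le_max lexx.
have uy : `|y1 - y0| <= u by rewrite le_max lexx orbT.
have u0 : 0 <= u by exact: le_trans ux.
have ur : u <= 2 * r.
  rewrite ge_max; apply/andP; split.
    have := ler_normD (x1 - xb) (xb - x0); rewrite subrKA.
    by rewrite [`|xb - x0|]distrC; lra.
  have := ler_normD (y1 - yb) (yb - y0); rewrite subrKA.
  by rewrite [`|yb - y0|]distrC; lra.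
have lip w w' v v' : Omega w -> Omega v -> Omega w' -> Omega v' ->
    m <= d w -> m <= d v -> m <= d w' -> m <= d v' ->
    `|w' - w| <= u -> `|v' - v| <= u -> k w' v' <= k w v + L * u.
  move=> Ow Ov Ow' Ov' dw dv dw' dv' ww vv.
  have scale z c : m <= d c -> `|z| <= u -> `|z| <= m^-1 * u * d c.
    move=> mc zu; apply: (le_trans zu).
    by rewrite mulrAC ler_peMl// mulrC ler_pdivlMr// mul1r.
  have := @qh_lipschitz w v w' v' (m^-1 * u) (m^-1 * u) Ow Ov Ow' Ov'
    (scale _ _ dw ww) (scale _ _ dw' ww) (scale _ _ dv vv) (scale _ _ dv' vv).
  by rewrite /L; lra.
have k10 := lip _ _ _ _ Ox0 Oy0 Ox1 Oy1 dx0 dy0 dx1 dy1 ux uy.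
have k01 : k x0 y0 <= k x1 y1 + L * u by apply: lip => //; rewrite distrC.
have LC : L * u <= C * u by rewrite ler_wpM2r// /C; lra.
split; first by rewrite ler_norml; apply/andP; split; lra.
move=> t /andP[t0 t1].
have [tE|tN] := eqVneq t 0; first by rewrite tE !scale0r !addr0 mul0r mulr0 mul0r !addr0.
have tp : 0 < t by rewrite lt_neqAle eq_sym tN.
have [uE|uN] := eqVneq u 0.
  have xE : x1 - x0 = 0 by apply/eqP; rewrite -normr_le0 -uE.
  have yE : y1 - y0 = 0 by apply/eqP; rewrite -normr_le0 -uE.
  move/eqP: xE; rewrite subr_eq0 => /eqP ->; move/eqP: yE; rewrite subr_eq0 => /eqP ->.
  by rewrite !subrr !scaler0 !addr0 mulr0 addr0 lerDl !mulr_ge0// exprn_ge0.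
have up : 0 < u by rewrite lt_neqAle eq_sym uN.
have Eu : E * u <= 1 / 2.
  have : E * u <= E * (2 * r) by rewrite ler_wpM2l//; lra.
  lra.
have u1 : 0 < u <= 1.
  rewrite up /=; have : u <= E * u by rewrite ler_peMl.
  lra.
have ELu : E * u * ((L + 1) * u) = E * (L + 1) * u ^+ 2 by ring.
have u2 : 0 <= t * u ^+ 2 by rewrite mulr_ge0// exprn_ge0.
have v2 : 0 <= t * (E * (L + 1) * u ^+ 2).
  by rewrite mulr_ge0// mulr_ge0// exprn_ge0.
have t2 : t * t <= t by rewrite ler_piMr.
have CE : C * t * u ^+ 2 = L * (t * u ^+ 2) + t * u ^+ 2 + 2 * (t * (E * (L + 1) * u ^+ 2)).
  by rewrite /C; ring.
have Lu : 0 <= L * (t * u ^+ 2) by rewrite mulr_ge0// ltW.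
have t1' : 0 < t <= 1 by rewrite tp.
have w1 : t * (t * u ^+ 2) <= t * u ^+ 2 by rewrite ler_piMl.
have w2 : 0 <= t * (t * u ^+ 2) by rewrite mulr_ge0.
have w3 : t * (t * (E * (L + 1) * u ^+ 2)) <= t * (E * (L + 1) * u ^+ 2).
  by rewrite ler_piMl.
have w4 : 0 <= t * (t * (E * (L + 1) * u ^+ 2)) by rewrite mulr_ge0.
have [le|lt] := leP (k x1 y1) (k x0 y0).
  have t01 : 0 <= t <= 1 by rewrite t0.
  have de : 0 <= k x0 y0 - k x1 y1 <= L * u by lra.
  have := qh_average_local Ox0 Oy0 Ox1 Oy1 m0 dy0 (ltW L0) t01 u1 uy Eu de t1'.
  rewrite -/E ELu CE; lra.
have t01 : 0 <= 1 - t <= 1 by lra.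
have de : 0 <= k x1 y1 - k x0 y0 <= L * u by lra.
have uy' : `|y0 - y1| <= u by rewrite distrC.
have := qh_average_local Ox1 Oy1 Ox0 Oy0 m0 dy1 (ltW L0) t01 u1 uy' Eu de t1'.
have swap (p q : X) : q + (1 - t) *: (p - q) = p + t *: (q - p).
  have -> : t *: (q - p) = - (t *: (p - q)) by rewrite -scalerN opprB.
  by rewrite scalerBl scale1r [LHS]addrC addrAC subrK.
rewrite !swap -/E ELu CE; lra.
Qed.

End quasihyperbolic.

(** * Generic differentiability of the quasihyperbolic distance *)

Theorem mainTheorem3 (R : realType) (X : completeNormedModType R)
    (Omega : set X) :
  separable X ->
  radon_nikodym_property X ->
  is_domain Omega ->
  convex_set Omega ->
  (exists2 G : set (X * X)%type,
      dense_Gdelta_in (Omega `*` Omega) G &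
      forall p, G p ->
        gateaux_differentiable (fun q : (X * X)%type => qh_metric Omega q.1 q.2) p)
  /\
  (forall x0, Omega x0 ->
    exists2 G : set X,
      dense_Gdelta_in Omega G &
      forall y, G y -> gateaux_differentiable (fun z => qh_metric Omega x0 z) y).
Proof.
move=> sepX _ [Oopen _ Obound] Oconvex; split.
  apply: generic_gateaux.
  - exact: separable_prod.
  - rewrite openE => -[a b] [/= Oa Ob].
    by exists (Omega, Omega) => //=; split; exact: open_nbhs_nbhs.
  - move=> [xb yb] [/= Oxb Oyb].
    have [r [C [r0 C0 H]]] := qh_local Oopen Obound Oconvex Oxb Oyb.
    have near1 (a : X * X) : `|a - (xb, yb)| < r -> `|a.1 - xb| < r.
      by rewrite prod_normE gt_max => /andP[].
    have near2 (a : X * X) : `|a - (xb, yb)| < r -> `|a.2 - yb| < r.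
      by rewrite prod_normE gt_max => /andP[].
    exists r, C; split => //.
    + move=> a b ar br.
      have [+ _] := H a.1 a.2 b.1 b.2 (near1 _ ar) (near2 _ ar) (near1 _ br) (near2 _ br).
      by rewrite [`|a - b|]distrC prod_normE.
    + move=> a b t ar br t01.
      have [_ /(_ t t01)] := H a.1 a.2 b.1 b.2 (near1 _ ar) (near2 _ ar) (near1 _ br) (near2 _ br).
      by rewrite prod_normE.
move=> x0 Ox0; apply: generic_gateaux => // yb Oyb.
have [r [C [r0 C0 H]]] := qh_local Oopen Obound Oconvex Ox0 Oyb.
have x0r : `|x0 - x0| < r by rewrite subrr normr0.
have maxE (z : X) : Num.max `|x0 - x0| `|z| = `|z|.
  by apply: max_r; rewrite subrr normr0.
exists r, C; split => //.
- move=> a b ar br; have [+ _] := H x0 a x0 b x0r ar x0r br.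
  by rewrite maxE [`|b - a|]distrC.
- move=> a b t ar br t01; have [_ /(_ t t01)] := H x0 a x0 b x0r ar x0r br.
  by rewrite maxE subrr scaler0 addr0.
Qed.
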